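(* Let $n,k,r,\ell$ be positive integers with $0<r<k$, and let $b,b_1,\dots,b_n$ and $s_1,\dots,s_{\ell+1}$ be nonnegative integers with $\sum_{i=1}^n b_i=b$, $\sum_{i=1}^n i\,b_i\le n$, $\sum_{i=1}^{\ell+1}s_i=n$ and $s_1=n-b$. Then the number of multichains $\pi_1\le\cdots\le\pi_\ell$ in $\mathrm{NC}^{(k)}(n;r)$ with rank jump vector $(s_1,\dots,s_{\ell+1})$ and $\mathrm{type}^{(k)}(\pi_1)=(b;b_1,\dots,b_n)$ equals $$\binom{b}{b_1,\dots,b_n}\binom{kn+r}{s_2}\cdots\binom{kn+r}{s_{\ell+1}}.$$
   Context: A partition of $[N]$ is noncrossing if there are no $a<b<c<d$ with $a,c$ in one block and $b,d$ in a different block. For $0<r<k$, $\mathrm{NC}^{(k)}(n;r)$ is the poset, ordered by refinement, of noncrossing partitions of $[kn+r]$ in which the sizes of all but one of the blocks are divisible by $k$. It is graded with $\mathrm{rank}(\pi)=n-\mathrm{bk}'(\pi)$, where $\mathrm{bk}'(\pi)$ is the number of blocks of size divisible by $k$; the maximum has rank $n$. $\mathrm{type}^{(k)}(\pi)=(b;b_1,\dots,b_n)$ where $b_i$ is the number of blocks of size $ki$ and $b=\sum b_i$. For a multichain $\pi_1\le\cdots\le\pi_\ell$ (repetitions allowed), the rank jump vector is $(s_1,\dots,s_{\ell+1})$ with $s_1=\mathrm{rank}(\pi_1)$, $s_i=\mathrm{rank}(\pi_i)-\mathrm{rank}(\pi_{i-1})$ for $2\le i\le\ell$, $s_{\ell+1}=n-\mathrm{rank}(\pi_\ell)$.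 *)

(* Defs.v *)
From mathcomp Require Import all_boot all_order.
Set Implicit Arguments. Unset Strict Implicit. Unset Printing Implicit Defensive.

(* A set partition of [N] = {0,...,N-1} (shifted by one from {1..N}, which
   does not affect crossings or block sizes) is P : {set {set 'I_N}} with
   finset's [partition P [set: 'I_N]]. *)

Definition noncrossing (N : nat) (P : {set {set 'I_N}}) : bool :=
  [forall B1 in P, forall B2 in P, (B1 != B2) ==>
    ~~ [exists a : 'I_N, exists b : 'I_N, exists c : 'I_N, exists d : 'I_N,
          [&& (a < b)%N, (b < c)%N, (c < d)%N,
              a \in B1, c \in B1, b \in B2 & d \in B2]]].

Definition inNCk (k n r : nat) (P : {set {set 'I_(k * n + r)}}) : bool :=
  [&& partition P [set: 'I_(k * n + r)], noncrossing P &
      #|[set B in P | ~~ (k %| #|B|)]| == 1].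

Definition refines (N : nat) (P Q : {set {set 'I_N}}) : bool :=
  [forall B in P, exists C in Q, B \subset C].

Definition bkp (k N : nat) (P : {set {set 'I_N}}) : nat :=
  #|[set B in P | k %| #|B|]|.

Definition rankNC (k n r : nat) (P : {set {set 'I_(k * n + r)}}) : nat :=
  n - bkp k P.

Definition typeb (k N : nat) (P : {set {set 'I_N}}) (i : nat) : nat :=
  #|[set B in P | #|B| == k * i]|.

Definition has_type (k n r : nat) (P : {set {set 'I_(k * n + r)}})
    (b : nat) (bs : nat -> nat) : bool :=
  (\sum_(1 <= i < n.+1) typeb k P i == b) &&
  [forall i : 'I_n, typeb k P i.+1 == bs i.+1].

(* multichains pi_1 <= ... <= pi_l in NC^(k)(n;r), encoded as c : 'I_l -> _
   with c i = pi_(i+1), having rank jump vector (s 1, ..., s (l+1)) and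
   type^(k)(pi_1) = (b; bs 1, ..., bs n). Rank jumps are stated as
   rank(pi_i) = rank(pi_(i-1)) + s_i, i.e. s_i = rank(pi_i) - rank(pi_(i-1)). *)
Definition good_multichain (k n r l b : nat) (bs s : nat -> nat)
    (c : {ffun 'I_l -> {set {set 'I_(k * n + r)}}}) : bool :=
  [&& [forall i : 'I_l, inNCk (c i)],
      [forall i : 'I_l, forall j : 'I_l,
         (j == i.+1 :> nat) ==> refines (c i) (c j)],
      [forall i : 'I_l, (i == 0 :> nat) ==> (rankNC (c i) == s 1)],
      [forall i : 'I_l, forall j : 'I_l,
         (j == i.+1 :> nat) ==> (rankNC (c j) == rankNC (c i) + s j.+1)],
      [forall i : 'I_l, (i == l.-1 :> nat) ==> (n == rankNC (c i) + s l.+1)] &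
      [forall i : 'I_l, (i == 0 :> nat) ==> has_type (c i) b bs]].

Definition multinomial (b : nat) (ms : seq nat) : nat :=
  b`! %/ \prod_(m <- ms) m`!.

(* Main.v *)
Require Import Defs.
From mathcomp Require Import all_boot all_order.
From mathcomp Require Import all_algebra.
From mathcomp Require Import mpoly ring zify.
Set Implicit Arguments. Unset Strict Implicit. Unset Printing Implicit Defensive.
Import GRing.Theory Num.Theory.

(** A coarsening of an element of [NC^(k)(n;r)] that is noncrossing lies again in
    [NC^(k)(n;r)], so with [N = kn+r] one has to count multichains of noncrossing partitions
    of [[N]] by ranks and by the block sizes of [pi_1].  Give a block of size [i] the weight
    [x_i] and put [A = sum_i x_i t^i].  With [B] the number of blocks of [pi_1] (here [b+1]),
    the weighted count [S] of the multichains satisfies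
      [B S = C(N,s_2) ... C(N,s_(l+1)) [t^N] A^B].
    Indeed, summing over [pi_1 <= pi_2] gives a block of [pi_2] of size [m] the weight
    [[t^m] G], where [G = y A(t(1+G))] is the series of noncrossing partitions and [y] marks
    blocks; this shortens the multichain, and Lagrange inversion evaluates [[t^N y^B] G^B'].
    The theorem is the coefficient of the monomial [x_z prod_i x_(ki)^(b_i)], with [z] the
    size of the block not divisible by [k]: the factor [B] cancels since that block is unique. *)

Local Open Scope ring_scope.

(** * Lagrange inversion for polynomials modulo a power of the variable *)

(** Congruence modulo [X^(N+1)]: power series are represented by polynomials compared up to degree
    [N]. *)
Definition eqmodX (R : nzRingType) (N : nat) (p q : {poly R}) :=
  forall i, (i <= N)%N -> p`_i = q`_i.

Section EqmodX.
Variables (R : comNzRingType) (N : nat).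
Implicit Types p q : {poly R}.

Lemma eqmodX_refl p : eqmodX N p p. Proof. by []. Qed.
Lemma eq_eqmodX p q : p = q -> eqmodX N p q. Proof. by move->. Qed.
Lemma eqmodX_sym p q : eqmodX N p q -> eqmodX N q p.
Proof. by move=> h i hi; rewrite h. Qed.
Lemma eqmodX_trans p q s : eqmodX N p q -> eqmodX N q s -> eqmodX N p s.
Proof. by move=> h1 h2 i hi; rewrite h1 ?h2. Qed.
Lemma eqmodXD p q p' q' :
  eqmodX N p q -> eqmodX N p' q' -> eqmodX N (p + p') (q + q').
Proof. by move=> h1 h2 i hi; rewrite !coefD h1 ?h2. Qed.
Lemma eqmodXM p q p' q' :
  eqmodX N p q -> eqmodX N p' q' -> eqmodX N (p * p') (q * q').
Proof.
move=> h1 h2 i hi; rewrite !coefM; apply: eq_bigr => j _.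
by rewrite h1 ?h2 //; [exact: leq_trans (leq_subr _ _) hi | rewrite (leq_trans _ hi) // -ltnS].
Qed.
Lemma eqmodX_exp p q j : eqmodX N p q -> eqmodX N (p ^+ j) (q ^+ j).
Proof. by move=> h; elim: j => [//|j ih]; rewrite !exprS; apply: eqmodXM. Qed.

End EqmodX.

Lemma coef_X_deriv (R : comNzRingType) (p : {poly R}) (m : nat) :
  ('X * p^`())`_m = m%:R * p`_m.
Proof. by rewrite coefXM; case: m => [|m]; rewrite ?mul0r // coef_deriv mulr_natl. Qed.

Section Lagrange.
Variables (R : idomainType) (R0 : forall n, n.+1%:R != 0 :> R) (N : nat).
Variables (phi W : {poly R}).
Hypothesis WE : eqmodX N W (phi \Po ('X * W)).

(** The term [p_i (XW)^i W^j] starts in degree [i], so only [i <= m] contributes. The factor [W^j]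
    is carried along because [W^(j+1)] will be rewritten as [phi(XW) W^j]. *)
Lemma coef_comp_mulX (p : {poly R}) (j m : nat) :
  ((p \Po ('X * W)) * W ^+ j)`_m =
  \sum_(i < m.+1) p`_i * (W ^+ (i + j))`_(m - i).
Proof.
rewrite comp_polyE mulr_suml coef_sum.
(* The two sums have lengths [size p] and [m + 1]; both are padded with zeros to the maximum. *)
transitivity (\sum_(i < maxn (size p) m.+1)
   (if (i <= m)%N then p`_i * (W ^+ (i + j))`_(m - i) else 0)).
  rewrite (big_ord_widen_cond (maxn (size p) m.+1) xpredT
    (fun i => (p`_i *: ('X * W) ^+ i * W ^+ j)`_m)) ?leq_maxl //.
  rewrite big_mkcond; apply: eq_bigr => i _ /=.
  rewrite -scalerAl coefZ exprMn -mulrA -exprD coefXnM.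
  have [hi|hi] := ltnP i (size p); last by rewrite nth_default // mul0r if_same.
  by case: ltnP; rewrite ?mulr0.
rewrite (big_ord_widen (maxn (size p) m.+1)
  (fun i => p`_i * (W ^+ (i + j))`_(m - i))) ?leq_maxr //.
by rewrite [RHS]big_mkcond.
Qed.

(** Lagrange inversion for powers, by induction on the index sum. Expanding [W^(j+1) = phi(XW) W^j]
    gives coefficients of [W^(i+j)] in degree [m - i]; all have index sum [m + j], so each becomes a
    coefficient of the same power [phi^(m+j)]. Of the resulting factor [i + j], the part [i] amounts
    to a derivative of [phi]. *)
Lemma lagrange_pow (m j : nat) : (m <= N)%N ->
  (m + j)%:R * (W ^+ j)`_m = j%:R * (phi ^+ (m + j))`_m.
Proof.
move: {2}(m + j)%N (erefl (m + j)%N) => L; elim: L m j => [|L ih] m j hL hm.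
  by move: hL => /eqP; rewrite addn_eq0 => /andP[/eqP-> /eqP->]; rewrite !mul0r.
case: j hL => [|j] hL.
  rewrite mul0r expr0 coef1 addn0; case: (m) => [|m'] /=; by rewrite ?mul0r ?mulr0.
have hL' : (m + j)%N = L by move: hL; rewrite addnS => -[].
have -> : (W ^+ j.+1)`_m = \sum_(i < m.+1) phi`_i * (W ^+ (i + j))`_(m - i).
  by rewrite -coef_comp_mulX exprS; apply: (eqmodXM WE (@eqmodX_refl _ _ _)).
have hsum : L%:R * \sum_(i < m.+1) phi`_i * (W ^+ (i + j))`_(m - i) =
   ('X * phi^`() * phi ^+ L)`_m + j%:R * (phi ^+ L.+1)`_m.
  rewrite exprS !coefM !mulr_sumr -big_split /=; apply: eq_bigr => i _.
  have hi : (i <= m)%N by rewrite -ltnS.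
  rewrite coef_X_deriv mulrCA.
  have e : (m - i + (i + j))%N = L by rewrite addnA subnK.
  rewrite -{1}e ih ?(leq_trans (leq_subr _ _)) // e natrD; ring.
have hder : L.+1%:R * ('X * phi^`() * phi ^+ L)`_m = m%:R * (phi ^+ L.+1)`_m.
  by rewrite -coef_X_deriv deriv_exp /= mulrnAr coefMn mulrA mulr_natl.
(* The rest divides by [L], so [L = 0] is treated apart; there [m = j = 0]. *)
rewrite hL; case: (L) hL' hsum hder => [|L'] hL' hsum hder.
  move/eqP: hL'; rewrite addn_eq0 => /andP[/eqP-> /eqP->].
  by rewrite big_ord1 !mul1r addn0 expr0 coef1 mulr1 expr1.
apply: (mulfI (R0 L')).
have eL : L'.+1%:R = m%:R + j%:R :> R by rewrite -hL' natrD.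
rewrite mulrCA hsum mulrDr hder -[L'.+2%:R]natr1 -[j.+1%:R]natr1 eL; ring.
Qed.

(** Both sides are linear in [p], and for [p = X^i] this is the power formula with exponent [i] in
    degree [N - i]. *)
Lemma lagrange_comp (p : {poly R}) :
  N%:R * (p \Po ('X * W))`_N = ('X * p^`() * phi ^+ N)`_N.
Proof.
have := coef_comp_mulX p 0 N; rewrite expr0 mulr1 => ->.
rewrite coefM mulr_sumr; apply: eq_bigr => i _.
have hi : (i <= N)%N by rewrite -ltnS.
have := lagrange_pow i (leq_subr i N); rewrite subnK // => h.
by rewrite addn0 coef_X_deriv mulrCA h; ring.
Qed.

End Lagrange.

(** The outer variable is [t], the inner one [y]. Inversion is applied with [W = 1 + G],
    [phi = 1 + yA] and [p = (yA)^(j+1)], since [p(XW)] agrees with [G^(j+1)]. *)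
Lemma lagrange_forest (R : idomainType) (R0 : forall n, n.+1%:R != 0 :> R)
    (N j s : nat) (A : {poly R}) (G : {poly {poly R}}) : (0 < N)%N ->
  eqmodX N G ('X%:P * A^:P \Po ('X * (1 + G))) ->
  (j.+1 + s)%:R * (G ^+ j.+1)`_N`_(j.+1 + s) =
  j.+1%:R * 'C(N, s)%:R * (A ^+ (j.+1 + s))`_N.
Proof.
move=> N0 GE.
have R0' n : n.+1%:R != 0 :> {poly R} by rewrite -polyC_natr polyC_eq0.
set yA := 'X%:P * A^:P in GE.
have WE : eqmodX N (1 + G) ((1 + yA) \Po ('X * (1 + G))).
  by rewrite comp_polyD comp_polyC; apply: eqmodXD.
have := lagrange_comp R0' WE (yA ^+ j.+1).
have -> : (yA ^+ j.+1 \Po ('X * (1 + G)))`_N = (G ^+ j.+1)`_N.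
  by rewrite rmorphXn /=; apply: eqmodX_exp (leqnn N); apply: eqmodX_sym.
move/(congr1 (fun p : {poly R} => p`_(j.+1 + s))).
rewrite [in LHS]mulr_natl coefMn -[in LHS]mulr_natl.
have yAX n : yA ^+ n = ('X^n)%:P * (A ^+ n)^:P.
  by rewrite /yA exprMn polyC_exp; congr (_ * _); rewrite rmorphXn.
(* The binomial expansion of [(1 + yA)^N] sorts by powers of [y]. Only [c = s] contributes to
   [y^(j+1+s)], which is where ['C(N, s)] comes from. *)
have -> : 'X * (yA ^+ j.+1)^`() * (1 + yA) ^+ N =
  \sum_(c < N.+1) ('X^(j.+1 + c))%:P * ('X * (A ^+ j.+1)^`() * A ^+ c)^:P *+ 'C(N, c).
  rewrite addrC exprD1n mulr_sumr; apply: eq_bigr => c _.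
  rewrite mulrnAr !yAX; congr (GRing.natmul _ _); rewrite mul_polyC derivZ -mul_polyC deriv_map.
  have -> : ('X * (A ^+ j.+1)^`() * A ^+ c)^:P = 'X * ((A ^+ j.+1)^`())^:P * (A ^+ c)^:P.
    by rewrite !rmorphM /= map_polyX.
  rewrite exprD polyCM -!mulrA mulrCA; congr (_ * _).
   by rewrite [X in _ * X = _]mulrCA [LHS]mulrCA.
have -> : (\sum_(c < N.+1) ('X^(j.+1 + c))%:P * ('X * (A ^+ j.+1)^`() * A ^+ c)^:P
     *+ 'C(N, c))`_N`_(j.+1 + s) =
  'C(N, s)%:R * ('X * (A ^+ j.+1)^`() * A ^+ s)`_N.
  rewrite coef_sum coef_sum.
  transitivity (\sum_(c < N.+1) if c == s :> nat then
      'C(N, s)%:R * ('X * (A ^+ j.+1)^`() * A ^+ s)`_N else 0).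
    apply: eq_bigr => c _; rewrite !coefMn coefCM coef_map coefMC coefXn eqn_add2l.
    by rewrite eq_sym; case: eqP => [->|_]; rewrite ?mul1r ?mulr_natl ?mul0r ?mul0rn.
  rewrite -big_mkcond /=; have [hs|hs] := ltnP s N.+1.
    by rewrite (big_pred1 (Ordinal hs)).
  rewrite big_pred0 ?bin_small ?mul0r // => c.
  by apply/eqP => e; move: (ltn_ord c); rewrite e ltnNge hs.
move=> h; have N1 : N%:R != 0 :> R by rewrite -(prednK N0).
apply: (mulfI N1); rewrite mulrCA h.
(* Both derivatives are multiples of [A^(j+s) A'], with factors [j + 1] and [j + 1 + s]. *)
have hd : (j.+1 + s)%:R * ('X * (A ^+ j.+1)^`() * A ^+ s)`_N =
    j.+1%:R * ('X * (A ^+ (j.+1 + s))^`())`_N.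
  rewrite !mulr_natl -!coefMn.
  have -> // : 'X * (A ^+ j.+1)^`() * A ^+ s *+ (j.+1 + s) =
    'X * (A ^+ (j.+1 + s))^`() *+ j.+1.
  by rewrite !deriv_exp addSn /= exprD !(mulrnAr, mulrnAl) -!mulrnA mulnC !mulrA.
by rewrite mulrCA hd coef_X_deriv; ring.
Qed.

(** * Noncrossing partitions *)

Section Crossing.
Variable N : nat.
Implicit Types (A B C D : {set 'I_N}) (P Q : {set {set 'I_N}}).

Definition crossing A B : bool :=
  [exists a : 'I_N, exists b : 'I_N, exists c : 'I_N, exists d : 'I_N,
     [&& (a < b)%N, (b < c)%N, (c < d)%N, a \in A, c \in A, b \in B & d \in B]].

Lemma crossingP A B :
  reflect (exists a b c d : 'I_N, [/\ (a < b)%N, (b < c)%N & (c < d)%N] /\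
             [/\ a \in A, c \in A, b \in B & d \in B])
          (crossing A B).
Proof.
apply: (iffP existsP) => [[a /existsP[b /existsP[c /existsP[d /and5P[ab bc cd aA /and3P[cA bB dB]]]]]]|].
  by exists a, b, c, d.
move=> [a [b [c [d [[ab bc cd] [aA cA bB dB]]]]]].
exists a; apply/existsP; exists b; apply/existsP; exists c; apply/existsP; exists d.
by apply/and5P; split => //; apply/and3P.
Qed.

Lemma crossingS A A' B B' :
  A \subset A' -> B \subset B' -> crossing A B -> crossing A' B'.
Proof.
move=> /subsetP sA /subsetP sB /crossingP[a [b [c [d [h [aA cA bB dB]]]]]].
by apply/crossingP; exists a, b, c, d; split => //; split; auto.
Qed.

Lemma noncrossingP P :
  reflect {in P &, forall B1 B2, B1 != B2 -> ~~ crossing B1 B2} (noncrossing P).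
Proof.
apply: (iffP forallP) => [h B1 B2 P1 P2 ne|h B1].
  by move: (h B1) => /implyP /(_ P1) /forallP /(_ B2) /implyP /(_ P2) /implyP /(_ ne).
apply/implyP => P1; apply/forallP => B2; apply/implyP => P2; apply/implyP => ne.
exact: h.
Qed.

Lemma noncrossing_setU P1 P2 :
    (forall B1 B2, B1 \in P1 -> B2 \in P2 -> ~~ crossing B1 B2 && ~~ crossing B2 B1) ->
  noncrossing (P1 :|: P2) = noncrossing P1 && noncrossing P2.
Proof.
move=> h; apply/noncrossingP/andP => [nc|[/noncrossingP n1 /noncrossingP n2] B1 B2].
  by split; apply/noncrossingP => B1 B2 h1 h2; apply: nc; rewrite in_setU ?h1 ?h2 ?orbT.
rewrite !in_setU => /orP[h1|h1] /orP[h2|h2] ne.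
- exact: n1.
- by case/andP: (h _ _ h1 h2).
- by case/andP: (h _ _ h2 h1).
- exact: n2.
Qed.

Lemma partition_sub P D B : partition P D -> B \in P -> B \subset D.
Proof. by move=> /cover_partition <- hB; apply: bigcup_sup hB. Qed.

Lemma partition_neq0 P D B : partition P D -> B \in P -> B != set0.
Proof. by move=> /and3P[_ _ h0] hB; apply: contraNneq h0 => <-. Qed.

Lemma partition_set1 P B : partition P B -> B \in P -> P = [set B].
Proof.
move=> pP BP; apply/setP => C; rewrite in_set1; apply/idP/eqP => [CP|-> //].
apply/eqP; apply: contraT => ne.
have /and3P[_ /trivIsetP /(_ _ _ CP BP ne) + _] := pP.
by rewrite disjoints_subset -setD_eq0 setDE setCK (setIidPl (partition_sub pP CP)) => h;
   rewrite (negbTE (partition_neq0 pP CP)) in h.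
Qed.

Lemma partition_setU P1 P2 D1 D2 : [disjoint D1 & D2] ->
  partition P1 D1 -> partition P2 D2 -> partition (P1 :|: P2) (D1 :|: D2).
Proof.
move=> dD p1 p2; apply/and3P; split.
- by rewrite /cover bigcup_setU -/(cover P1) -/(cover P2) !(cover_partition p1, cover_partition p2).
- have [_ /trivIsetP t1 _] := and3P p1; have [_ /trivIsetP t2 _] := and3P p2.
  apply/trivIsetP => B C; rewrite !in_setU => /orP[hB|hB] /orP[hC|hC] ne; auto.
    by apply: disjointWl (partition_sub p1 hB) (disjointWr (partition_sub p2 hC) dD).
  by rewrite disjoint_sym; apply: disjointWl (partition_sub p1 hC) (disjointWr (partition_sub p2 hB) dD).
- by rewrite in_setU; case/and3P: p1 => _ _ /negPf ->; case/and3P: p2.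
Qed.

Lemma partition_restrict P D1 D2 : [disjoint D1 & D2] ->
    partition P (D1 :|: D2) -> {in P, forall B, (B \subset D1) || (B \subset D2)} ->
  partition [set B in P | B \subset D1] D1.
Proof.
move=> dD pP h; have /and3P[/eqP cP tP nP] := pP.
apply/and3P; split; last by rewrite inE negb_and nP.
  apply/eqP/setP => x; apply/bigcupP/idP => [[B]|xD1].
    by rewrite inE => /andP[_ /subsetP sB] xB; apply: sB.
  have: x \in cover P by rewrite cP inE xD1.
  case/bigcupP => B BP xB; exists B => //; rewrite inE BP /=.
  case/orP: (h B BP) => // /subsetP sB; have xD2 := sB x xB.
  by move/pred0P: dD => /(_ x) /=; rewrite xD1 xD2.
apply/trivIsetP => B C; rewrite !inE => /andP[hB _] /andP[hC _].
by move/trivIsetP: tP => /(_ B C hB hC).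
Qed.

(** A partition none of whose blocks straddles [D1] and [D2] is the same as a pair of partitions;
    the pair is recovered by selecting the blocks inside each part. *)
Lemma big_partition_setU (R : nmodType) (F : {set {set 'I_N}} -> R) D1 D2 :
  [disjoint D1 & D2] ->
  \sum_(P | partition P (D1 :|: D2) && [forall B in P, (B \subset D1) || (B \subset D2)]) F P
  = \sum_(P1 | partition P1 D1) \sum_(P2 | partition P2 D2) F (P1 :|: P2).
Proof.
move=> dD; rewrite pair_big_dep /=.
rewrite (reindex_onto (fun p => p.1 :|: p.2)
  (fun P => ([set B in P | B \subset D1], [set B in P | B \subset D2]))) /=.
  apply: eq_bigl => -[P1 P2] /=; apply/idP/idP => [|/andP[p1 p2]].
    case/andP => /andP[pP hP] /eqP[e1 e2].
    have hP' : {in P1 :|: P2, forall B, (B \subset D1) || (B \subset D2)}.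
      by move=> B BP; move/forallP: hP => /(_ B) /implyP; apply.
    apply/andP; split; first by rewrite -e1; apply: partition_restrict pP hP'.
    rewrite -e2; apply: (@partition_restrict _ _ D1); rewrite 1?disjoint_sym 1?(setUC D2) //.
    by move=> B /hP'; rewrite orbC.
  rewrite partition_setU //=; apply/andP; split.
    apply/forallP => B; apply/implyP; rewrite in_setU.
    by move=> /orP[/(partition_sub p1)|/(partition_sub p2)] ->; rewrite ?orbT.
  (* A block of [P'] contained in [E] would be empty, so selection by inclusion returns exactly
     [P]. *)
  have key P P' E E' : partition P E -> partition P' E' -> [disjoint E & E'] ->
      [set B in P :|: P' | B \subset E] = P.
    move=> pP pP' dE; apply/setP => B; rewrite !inE; apply/idP/idP => [|BP].
      case/andP => /orP[//|BP'] BE.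
      have := partition_neq0 pP' BP'; rewrite -subset0.
      by rewrite -(disjoint_setI0 dE) subsetI BE (partition_sub pP' BP').
    by rewrite BP (partition_sub pP BP).
  by rewrite (key _ _ _ _ p1 p2) // setUC (key _ _ _ _ p2 p1) // disjoint_sym.
move=> P /andP[pP /forallP hP]; apply/setP => B; rewrite !inE.
by case: (boolP (B \in P)) => //= BP; move: (hP B); rewrite BP.
Qed.

End Crossing.

(** * Weighted sums over noncrossing partitions of a subset *)

Section Weights.
Variables (N : nat) (R : comNzRingType) (x : nat -> R).
Implicit Types (A B C D : {set 'I_N}) (P Q : {set {set 'I_N}}).

Definition weight P : R := \prod_(B in P) x #|B|.

Definition ncsum D : R := \sum_(P | partition P D && noncrossing P) weight P.

Lemma weight_setU P1 P2 D1 D2 : [disjoint D1 & D2] -> partition P1 D1 -> partition P2 D2 ->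
  weight (P1 :|: P2) = weight P1 * weight P2.
Proof.
move=> dD p1 p2; rewrite /weight -bigU /=; first by apply: eq_bigl => B; rewrite !inE.
rewrite -setI_eq0; apply/eqP/setP => B; rewrite !inE; apply/negP => /andP[h1 h2].
have := partition_neq0 p1 h1; rewrite -subset0 -(disjoint_setI0 dD) subsetI.
by rewrite (partition_sub p1 h1) (partition_sub p2 h2).
Qed.

Definition ncsum_refining Q D : R :=
  \sum_(P | [&& partition P D, noncrossing P & refines P Q]) weight P.

Lemma refinesP P Q :
  reflect {in P, forall B, exists2 C, C \in Q & B \subset C} (refines P Q).
Proof.
apply: (iffP forallP) => h B.
  by move=> BP; have /implyP/(_ BP)/existsP[C /andP[CQ BC]] := h B; exists C.
by apply/implyP => /h[C CQ BC]; apply/existsP; exists C; rewrite CQ.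
Qed.

(* Each block of [Q] is refined independently of the others. *)
Lemma ncsum_refining_prod Q : trivIset Q -> set0 \notin Q -> noncrossing Q ->
  ncsum_refining Q (cover Q) = \prod_(C in Q) ncsum C.
Proof.
move: {2}#|Q| (erefl #|Q|) => q; elim: q Q => [|q ih] Q hq tQ Q0 nQ.
  move/eqP: hq; rewrite cards_eq0 => /eqP ->.
  rewrite big_set0 /cover big_set0 /ncsum_refining (big_pred1 set0) /weight ?big_set0 // => P /=.
  rewrite partition_set0 andbC; case: eqP => [->|]; rewrite ?andbF // andbT.
  by apply/andP; split; [apply/noncrossingP => ? ?; rewrite inE | apply/refinesP => ?; rewrite inE].
have [C CQ] : exists C, C \in Q by apply/set0Pn; rewrite -cards_eq0 hq.
pose Q' := Q :\ C.
have sQ' : Q' \subset Q by apply: subsetDl.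
have memQ' E : (E \in Q') = (E != C) && (E \in Q) by rewrite in_setD1.
have QE : Q = C |: Q' by rewrite setD1K.
have dC : [disjoint C & cover Q'].
  apply: bigcup_disjoint => B; rewrite !inE => /andP[ne BQ].
  by move/trivIsetP: tQ; apply; rewrite // eq_sym.
have nQ' : noncrossing Q'.
  apply/noncrossingP => B1 B2 h1 h2; move/noncrossingP: nQ; apply; exact: (subsetP sQ').
rewrite (big_setD1 C) //= -/Q' -ih //; first last.
- by apply: contraNN Q0; apply: (subsetP sQ').
- exact: trivIsetS tQ.
- by apply/eqP; rewrite -eqSS -hq (cardsD1 C Q) CQ.
rewrite /ncsum_refining /ncsum big_distrlr /=.
have -> : cover Q = C :|: cover Q'.
  by rewrite /cover (big_setD1 C CQ).
pose F P := if noncrossing P && refines P Q then weight P else 0.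
transitivity (\sum_(P | partition P (C :|: cover Q') &&
    [forall B in P, (B \subset C) || (B \subset cover Q')]) F P).
  rewrite /F -big_mkcondr; apply: eq_bigl => P; rewrite -andbA; congr (_ && _).
  rewrite andbA andbC; case: (boolP (refines P Q)) => rP; rewrite ?andbF // andbT.
  rewrite (_ : [forall B in P, _]) //; apply/forallP => B; apply/implyP => /(refinesP _ _ rP)[E].
  rewrite QE in_setU1 => /orP[/eqP -> ->//|EQ BE]; apply/orP; right.
  by apply: subset_trans BE _; apply: bigcup_sup EQ.
rewrite big_partition_setU // [RHS]big_mkcondr /=; apply: eq_bigr => P1 p1.
have refP1 P2 : partition P2 (cover Q') -> refines (P1 :|: P2) Q = refines P2 Q'.
  move=> p2; apply/refinesP/refinesP => h B.
    move=> B2; have [|E EQ BE] := h B; first by rewrite inE B2 orbT.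
    exists E => //; rewrite memQ' EQ andbT; apply/eqP => EC; subst E.
    have := partition_neq0 p2 B2; rewrite -subset0 -(disjoint_setI0 dC) subsetI BE.
    by rewrite (partition_sub p2 B2).
  rewrite inE => /orP[B1|/h[E EQ BE]]; last by exists E => //; apply: (subsetP sQ').
  by exists C => //; apply: partition_sub B1.
(* A crossing between a block inside [C] and one inside another block [E] of [Q] would make [C] and
   [E] cross. *)
have ncP1 P2 : partition P2 (cover Q') -> refines P2 Q' ->
    noncrossing (P1 :|: P2) = noncrossing P1 && noncrossing P2.
  move=> p2 /refinesP r2; apply: noncrossing_setU => B1 B2 h1 /r2[E EQ BE].
  move: EQ; rewrite memQ' => /andP[ne EQ]; have BC := partition_sub p1 h1.
  have /noncrossingP n := nQ.
  have ne' : C != E by rewrite eq_sym.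
  by apply/andP; split; [move: (n C E CQ EQ ne') | move: (n E C EQ CQ ne)];
    apply: contraNN; apply: crossingS.
transitivity (\sum_(P2 | partition P2 (cover Q'))
   if noncrossing P1 then if noncrossing P2 && refines P2 Q' then weight P1 * weight P2 else 0 else 0).
  apply: eq_bigr => P2 p2; rewrite /F refP1 //.
  case: (boolP (refines P2 Q')) => r2; rewrite ?andbF ?if_same // !andbT ncP1 //.
  by rewrite (weight_setU dC) //; case: (noncrossing P1).
case: (noncrossing P1); last by rewrite big1.
by rewrite -big_mkcondr.
Qed.

(** The factor of [B] itself is left out: it is supplied separately, with a shifted size. *)
Definition ncsum_with_block B D : R :=
  \sum_(P | partition P D && noncrossing (B |: P)) weight P.

(* Here [d] is the largest element and the size of its block is counted [j] too large: this
   records the [j] elements of that block already removed by the recursion below. *)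
Definition ncsum_shifted (j : nat) (d : 'I_N) D : R :=
  \sum_(B : {set 'I_N} | (d \in B) && (B \subset d |: D))
     x (#|B| + j) * ncsum_with_block B ((d |: D) :\: B).

Lemma andb_implied_mid (p q f : bool) : (p -> q -> f) -> p && q = (p && f) && q.
Proof. by case: p; case: q; case: f => // /(_ isT isT). Qed.

Lemma partition_nonempty_notin P D B (d : 'I_N) :
  partition P (D :\: B) -> d \in B -> B \notin P.
Proof.
move=> pP dB; apply/negP => /(partition_sub pP)/subsetP/(_ d dB).
by rewrite inE dB.
Qed.

(** The partitions are sorted by the block [B] containing [d]. *)
Lemma ncsum_is_shifted0 (d : 'I_N) D : ncsum (d |: D) = ncsum_shifted 0 d D.
Proof.
set D1 := d |: D.
have dD1 : d \in D1 by rewrite setU11.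
transitivity (\sum_(B : {set 'I_N} | (d \in B) && (B \subset D1))
   \sum_(P | partition P D1 && noncrossing P) if B \in P then weight P else 0).
  rewrite exchange_big /=; apply: eq_bigr => P /andP[pP _].
  have dc : d \in cover P by rewrite (cover_partition pP).
  have [_ tP _] := and3P pP.
  rewrite -big_mkcondr (big_pred1 (pblock P d)) // => B; apply/idP/eqP.
    by case/andP => /andP[dB _] BP; rewrite (def_pblock tP BP dB).
  move=> ->; rewrite mem_pblock dc pblock_mem // andbT /=.
  by apply: partition_sub pP _; apply: pblock_mem.
apply: eq_bigr => B /andP[dB BD].
have DE : D1 = B :|: (D1 :\: B) by rewrite setDE setUIr setUCr setIT (setUidPr BD).
have dj : [disjoint B & D1 :\: B] by rewrite -setI_eq0 setDE setICA setICr setI0.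
pose F P := if noncrossing P && (B \in P) then weight P else 0.
transitivity (\sum_(P | partition P (B :|: (D1 :\: B)) &&
   [forall C in P, (C \subset B) || (C \subset D1 :\: B)]) F P).
  rewrite -DE /F -!big_mkcondr; apply: eq_bigl => P.
  rewrite -andbA; apply: andb_implied_mid => pP /andP[_ BP].
  apply/forallP => C; apply/implyP => CP; case: (eqVneq C B) => [->|ne]; first by rewrite subxx.
  rewrite orbC subsetD (partition_sub pP CP) /=.
  by have [_ /trivIsetP t _] := and3P pP; rewrite t.
(* As [B] must itself be a block, the part on [B] can only be [[set B]]; every other term
   vanishes. *)
rewrite big_partition_setU // (bigD1 [set B]) /=; last first.
  apply/and3P; split; rewrite ?inE; [by rewrite /cover big_set1| |].
    by apply/trivIsetP => ? ?; rewrite !inE => /eqP -> /eqP ->; rewrite eqxx.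
  by apply/eqP => e; rewrite -e inE in dB.
rewrite [X in _ + X]big1 ?addr0 => [|P1 /andP[p1 ne]]; last first.
  rewrite big1 // => P2 p2; rewrite /F inE (negPf (partition_nonempty_notin p2 dB)) orbF.
  case: (boolP (B \in P1)) => BP1; rewrite ?andbF //.
  by rewrite (partition_set1 p1 BP1) eqxx in ne.
rewrite /ncsum_with_block mulr_sumr [RHS]big_mkcondr /=; apply: eq_bigr => P p2.
rewrite /F setU11 andbT; case: (noncrossing _) => //.
by rewrite /weight big_setU1 ?addn0 //= (partition_nonempty_notin p2 dB).
Qed.

Lemma noncrossing_setU1 B P : B \notin P ->
  noncrossing (B |: P) =
  noncrossing P && [forall C in P, ~~ (crossing B C || crossing C B)].
Proof.
move=> BP; apply/noncrossingP/andP => [h|[/noncrossingP h /forallP h'] B1 B2].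
  split; first by apply/noncrossingP => B1 B2 h1 h2; apply: h; rewrite in_setU ?h1 ?h2 orbT.
  apply/forallP => C; apply/implyP => CP; rewrite negb_or.
  have ne : B != C by apply: contraNneq BP => ->.
  by rewrite !h // ?in_setU1 ?eqxx ?CP ?orbT // eq_sym.
rewrite !in_setU1 => /predU1P[->|h1] /predU1P[->|h2]; rewrite ?eqxx //.
- by move: (h' B2); rewrite h2 negb_or => /andP[].
- by move: (h' B1); rewrite h1 negb_or => /andP[].
- exact: h.
Qed.

(** A crossing takes two elements from each block, so a singleton crosses nothing. *)
Lemma ncsum_with_block_set1 (d : 'I_N) D : d \notin D -> ncsum_with_block [set d] D = ncsum D.
Proof.
move=> dD; apply: eq_bigl => P; apply: andb_id2l => pP.
rewrite noncrossing_setU1; last first.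
  by apply: contraNN dD => /(partition_sub pP); rewrite sub1set.
case: (noncrossing P) => //=; apply/forallP => C; apply/implyP => _.
apply/negP => /orP[] /crossingP[a [b [c [e [[ab bc ce] []]]]]]; rewrite !inE.
  by move=> /eqP aE /eqP cE _ _; move: (ltn_trans ab bc); rewrite aE cE ltnn.
by move=> _ _ /eqP bE /eqP eE; move: (ltn_trans bc ce); rewrite bE eE ltnn.
Qed.

(* The elements between [e] and [d], the two largest elements of the block [d |: B], form
   unions of blocks; after removing them, dropping [d] from the block changes no crossing. *)
Lemma ncsum_with_block_setU1 (d e : 'I_N) D B :
  {in D, forall y : 'I_N, (y < d)%N} -> e \in B -> B \subset [set y in D | (y <= e)%N] ->
  ncsum_with_block (d |: B) (D :\: B) =
  ncsum [set y in D | (e < y)%N] * ncsum_with_block B ([set y in D | (y <= e)%N] :\: B).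
Proof.
move=> Dd eB BL; set U := [set y in D | (e < y)%N]; set L := [set y in D | (y <= e)%N].
have UL : [disjoint U & L :\: B].
  rewrite -setI_eq0; apply/eqP/setP => y; rewrite !inE; apply/negP.
  by case/andP => /andP[_ ey] /and3P[_ _]; rewrite leqNgt ey.
have DE : D :\: B = U :|: (L :\: B).
  apply/setP => y; rewrite !inE; case: (boolP (y \in B)) => /= yB.
    by rewrite orbF; move/subsetP: BL => /(_ y yB); rewrite inE leqNgt => /andP[-> /negPf ->].
  by case: (y \in D) => //=; rewrite ltnNge orNb.
have dD y : y \in D -> y != d by move/Dd => h; apply: contraTneq h => ->; rewrite ltnn.
have dP P : partition P (D :\: B) -> d |: B \notin P.
  move=> pP; apply/negP => /(partition_sub pP)/subsetP/(_ d (setU11 _ _)).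
  by rewrite inE => /andP[_ /dD]; rewrite eqxx.
pose F P := if noncrossing (d |: B |: P) then weight P else 0.
transitivity (\sum_(P | partition P (U :|: (L :\: B)) &&
   [forall C in P, (C \subset U) || (C \subset L :\: B)]) F P).
  rewrite -DE /F -big_mkcondr; apply: eq_bigl => P.
  apply: andb_implied_mid => pP nc.
  apply/forallP => C; apply/implyP => CP.
  rewrite -[X in X || _]negbK -[X in _ || X]negbK -negb_and; apply/negP.
  case/andP => /subsetPn[l lC lU] /subsetPn[u uC uL].
  have := partition_sub pP CP; rewrite DE => /subsetP sC.
  have := sC l lC; rewrite inE (negPf lU) /= !inE => /and3P[lB lD le].
  have := sC u uC; rewrite inE (negPf uL) orbF inE => /andP[uD eu].
  move: nc; rewrite noncrossing_setU1 ?dP // => /andP[_ /forallP/(_ C)].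
  rewrite CP /= negb_or => /andP[_ /negP]; apply.
  (* A block with elements [l] and [u] on both sides of [e] crosses [d |: B] along
     [l < e < u < d]. *)
  apply/crossingP; exists l, e, u, d; split; split; rewrite ?setU11 ?inE ?eB ?orbT //.
    by rewrite ltn_neqAle le andbT; apply: contraNneq lB => /ord_inj ->.
  exact: Dd.
rewrite big_partition_setU // /ncsum /ncsum_with_block big_distrlr /= [RHS]big_mkcondr /=.
apply: eq_bigr => P1 p1.
transitivity (\sum_(P2 | partition P2 (L :\: B))
  if noncrossing P1 then if noncrossing (B |: P2) then weight P1 * weight P2 else 0 else 0); last first.
  by case: (noncrossing P1); [rewrite -big_mkcondr | rewrite big1].
apply: eq_bigr => P2 p2; rewrite /F (weight_setU UL) //.
suff -> : noncrossing (d |: B |: (P1 :|: P2)) = noncrossing P1 && noncrossing (B |: P2).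
  by case: (noncrossing P1).
rewrite setUCA noncrossing_setU; last first.
  move=> B1 B2 h1 h2.
  (* The blocks of [P1] lie strictly between [e] and [d], where no element of [d |: B] or of [P2]
     lies; hence they cross none of these blocks. *)
  have s1 (y : 'I_N) : y \in B1 -> (e < y < d)%N.
    move=> yB; move/subsetP: (partition_sub p1 h1) => /(_ y yB).
    by rewrite inE => /andP[/Dd -> ->].
  have s2 (y : 'I_N) : y \in B2 -> (e < y < d)%N -> False.
    move=> yB /andP[ey yd]; move: h2; rewrite in_setU1 => /predU1P[h|h].
      move: yB; rewrite h in_setU1 => /predU1P[hh|/(subsetP BL)].
        by rewrite hh ltnn in yd.
      by rewrite inE leqNgt ey andbF.
    by move: (subsetP (partition_sub p2 h) y yB); rewrite !inE leqNgt ey !andbF.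
  apply/andP; split; apply/negP => /crossingP[a [b [c [f [[ab bc cf] [h1' h2' h3' h4']]]]]].
    apply: (s2 b) => //; have /andP[ea _] := s1 _ h1'; have /andP[_ cd] := s1 _ h2'.
    by rewrite (ltn_trans ea ab) (ltn_trans bc cd).
  apply: (s2 c) => //; have /andP[eb _] := s1 _ h3'; have /andP[_ fd] := s1 _ h4'.
  by rewrite (ltn_trans eb bc) (ltn_trans cf fd).
congr (_ && _).
have nB : d |: B \notin P2.
  apply/negP => /(partition_sub p2)/subsetP/(_ d (setU11 _ _)).
  by rewrite !inE => /and3P[_ /dD]; rewrite eqxx.
rewrite !noncrossing_setU1 // ?(partition_nonempty_notin p2 eB) //; congr (_ && _).
apply: eq_forallb_in => C CP2; congr (~~ _).
have sC (y : 'I_N) : y \in C -> (y < e)%N /\ (y < d)%N.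
  move/(subsetP (partition_sub p2 CP2)); rewrite !inE => /and3P[yB /Dd yd ye].
  by split => //; rewrite ltn_neqAle ye andbT; apply: contraNneq yB => /ord_inj ->.
apply/idP/idP; last first.
  by case/orP => h; apply/orP; [left|right]; apply: crossingS h; rewrite ?subsetUr.
case/orP => /crossingP[a [b [c [f [[ab bc cf] [h1 h2 h3 h4]]]]]]; apply/orP.
  left; apply/crossingP; exists a, b, c, f; split; split => //.
    move: h1; rewrite in_setU1 => /predU1P[aE|//]; have [_] := sC _ h3.
    by rewrite -aE ltnNge (ltnW ab).
  move: h2; rewrite in_setU1 => /predU1P[aE|//]; have [_] := sC _ h4.
  by rewrite -aE ltnNge (ltnW cf).
right; apply/crossingP.
have bB : b \in B.
  move: h3; rewrite in_setU1 => /predU1P[aE|//]; have [_] := sC _ h2.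
  by rewrite -aE ltnNge (ltnW bc).
(* If the last element of the crossing is [d], it can be replaced by [e], because all elements of
   [C] lie below [e]. *)
move: h4; rewrite in_setU1 => /predU1P[fE|fB]; last by exists a, b, c, f.
by exists a, b, c, e; split; split => //; case: (sC _ h2).
Qed.

(** Either the block of [d] is a singleton, or it has a second largest element [e]. In that case [d]
    is dropped from the block, the shift grows by one to keep its weight, and the elements between
    [e] and [d] split off as an independent factor. *)
Lemma ncsum_shifted_rec (j : nat) (d : 'I_N) D :
  {in D, forall y : 'I_N, (y < d)%N} ->
  ncsum_shifted j d D = x j.+1 * ncsum D +
    \sum_(e in D) ncsum [set y in D | (e < y)%N] * ncsum_shifted j.+1 e [set y in D | (y < e)%N].
Proof.
move=> Dd.
have dD : d \notin D by apply/negP => /Dd; rewrite ltnn.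
rewrite /ncsum_shifted (bigD1 [set d]) /=; last by rewrite set11 sub1set setU11.
congr (_ + _); first by rewrite cards1 add1n setU1K // ncsum_with_block_set1.
transitivity (\sum_(B : {set 'I_N} | (B \subset D) && (B != set0))
    x (#|B| + j.+1) * ncsum_with_block (d |: B) (D :\: B)).
  rewrite (reindex_onto (fun B => d |: B) (fun B => B :\ d)) /=; last first.
    by move=> B /andP[/andP[dB _] _]; rewrite setD1K.
  have BD B : B \subset D -> d \notin B by move=> s; apply: contraNN dD; apply: (subsetP s).
  apply: eq_big => [B|B]; last first.
    move=> /andP[_ /eqP hB]; have dB : d \notin B by rewrite -hB !inE eqxx.
    rewrite cardsU1 dB addSnnS; congr (_ * ncsum_with_block _ _).
    apply/setP => y; rewrite !inE; case: eqP => //= ->; by rewrite (negPf dD) andbF.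
  rewrite setU11 /=; apply/idP/idP.
    case/andP => /andP[s ne] /eqP hB; have dB : d \notin B by rewrite -hB !inE eqxx.
    apply/andP; split; last by apply: contraNneq ne => ->; rewrite setU0.
    by rewrite -(setU1K dD) -(setU1K dB) setSD.
  case/andP => s ne; rewrite setU1K ?BD // eqxx andbT setUS //=.
  apply: contraNneq ne => h; rewrite -subset0; apply/subsetP => y yB.
  have : y \in [set d] by rewrite -h inE yB orbT.
  by rewrite inE => /eqP yd; move: (BD _ s); rewrite -yd yB.
(* The inner sum has the single index [e = max B]; exchanging the sums then sorts the sets [B] by
   their maximum. *)
transitivity (\sum_(B : {set 'I_N} | (B \subset D) && (B != set0))
   \sum_(e in D | (e \in B) && (B \subset [set y in D | (y <= e)%N]))
    x (#|B| + j.+1) * ncsum_with_block (d |: B) (D :\: B)).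
  apply: eq_bigr => B /andP[BD /set0Pn[b0 b0B]].
  have [e eB emax] := arg_maxnP (fun i : 'I_N => i : nat) b0B.
  have {}eB : e \in B := eB.
  rewrite (big_pred1 e) // => f /=; apply/idP/eqP.
    case/and3P => _ fB /subsetP s; apply/ord_inj/eqP; rewrite eqn_leq.
    by rewrite (emax f fB : (f <= e)%N); move: (s e eB); rewrite inE => /andP[_ ->].
  move=> ->; rewrite (subsetP BD) //= eB; apply/subsetP => y yB.
  by rewrite inE (subsetP BD) //=; apply: emax.
rewrite (exchange_big_dep (mem D)) /=; last by move=> ? ? _ /andP[].
apply: eq_bigr => e eD; rewrite mulr_sumr.
have LE : [set y in D | (y <= e)%N] = e |: [set y in D | (y < e)%N].
  apply/setP => y; rewrite !inE leq_eqVlt; case: (eqVneq y e) => [->|ne] /=.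
    by rewrite eqxx eD.
  by rewrite -(inj_eq (@ord_inj N)) in ne; rewrite (negPf ne).
apply: eq_big => [B|B].
  rewrite eD /= -LE; apply/idP/idP => [/andP[_ ->]//|/andP[eB s]]; rewrite eB s !andbT.
  rewrite (subset_trans s) /=; last by apply/subsetP => y; rewrite inE => /andP[].
  by apply/set0Pn; exists e.
case/andP => _ /and3P[_ eB s]; rewrite (ncsum_with_block_setU1 Dd eB s) LE; ring.
Qed.

End Weights.

(** * The series of noncrossing partitions *)

Lemma card_below_above (N : nat) (D : {set 'I_N}) (e : 'I_N) : e \in D ->
  #|[set y in D | (e < y)%N]| = (#|D| - #|[set y in D | (y < e)%N]|.+1)%N.
Proof.
move=> eD; rewrite (cardsD1 e D) eD add1n subSS.
have -> : D :\ e = [set y in D | (y < e)%N] :|: [set y in D | (e < y)%N].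
  apply/setP => y; rewrite !inE; case: ltngtP => [||/ord_inj ->]; rewrite ?eqxx ?andbF //.
    by move=> h; rewrite orbF andbT andb_idl // => _; apply: contraTneq h => ->; rewrite ltnn.
  by move=> h; rewrite andbT andb_idl // => _; apply: contraTneq h => ->; rewrite ltnn.
rewrite cardsU disjoint_setI0 ?cards0 ?subn0 ?addKn //.
rewrite -setI_eq0; apply/eqP/setP => y; rewrite !inE.
by case: ltngtP => //; rewrite ?andbF.
Qed.

(** Counting the smaller elements of [D] numbers its elements [0, ..., #|D| - 1]; the induction
    removes the maximum. *)
Lemma big_rank (R : nmodType) (N : nat) (D : {set 'I_N}) (F : nat -> R) :
  \sum_(e in D) F #|[set y in D | (y < e)%N]| = \sum_(i < #|D|) F i.
Proof.
move: {2}#|D| (erefl #|D|) => m; elim: m D => [|m ih] D hD.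
  by rewrite hD big_ord0; move/eqP: hD; rewrite cards_eq0 => /eqP ->; rewrite big_set0.
have [d0 d0D] : exists d, d \in D by apply/set0Pn; rewrite -cards_eq0 hD.
have [d dD dmax] := arg_maxnP (fun i : 'I_N => i : nat) d0D.
have {}dD : d \in D := dD.
have hD' : #|D :\ d| = m by apply/eqP; rewrite -eqSS -hD (cardsD1 d D) dD.
rewrite hD big_ord_recr /= (big_setD1 d) //= addrC; congr (_ + _).
  rewrite -hD' -ih //; apply: eq_bigr => e; rewrite in_setD1 => /andP[ne eD].
  congr (F #|pred_of_set _|); apply/setP => y; rewrite !inE; case: (eqVneq y d) => //= ->.
  by rewrite dD ltnNge (dmax e eD : (e <= d)%N).
rewrite -hD'; congr (F #|pred_of_set _|); apply/setP => y; rewrite !inE.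
case: (boolP (y \in D)) => yD; rewrite ?andbF //= andbT.
by rewrite ltn_neqAle (dmax y yD : (y <= d)%N) andbT (inj_eq (@ord_inj N)).
Qed.

Section Sizes.
Variables (N : nat) (R : comNzRingType) (x : nat -> R).
Implicit Types (D : {set 'I_N}).

Lemma ncsum_set0 : ncsum x (set0 : {set 'I_N}) = 1.
Proof.
rewrite /ncsum (big_pred1 set0) /weight ?big_set0 // => P /=.
rewrite partition_set0; case: eqP => // ->; rewrite andTb.
by apply/noncrossingP => ? ?; rewrite inE.
Qed.

(** The recursion for [ncsum_shifted] in terms of cardinalities alone. Here [w i] stands for [ncsum]
    on [i] elements; for [i > 0] the maximum is not counted in the second argument of [v], hence the
    predecessor. *)
Definition shifted_step (v : nat -> nat -> R) (j m : nat) : R :=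
  let w i := if i is i'.+1 then v 0%N i' else 1 in
  x j.+1 * w m + \sum_(i < m) w (m - i.+1)%N * v j.+1 i.

(** The step at [m] consults [v] only at smaller sizes, so the recursion is well founded. *)
Lemma eq_shifted_step v v' j m : (forall i n, (n < m)%N -> v i n = v' i n) ->
  shifted_step v j m = shifted_step v' j m.
Proof.
move=> h; rewrite /shifted_step; congr (_ * _ + _); first by case: m h => // m ->.
apply: eq_bigr => i _; rewrite h //; congr (_ * _).
case e: (m - i.+1)%N => [|n] //; apply: h.
by rewrite -e leq_subr.
Qed.

(** By strong induction on [#|D|]: all sets in the recursion are smaller, and it sees them only
    through their sizes. *)
Lemma ncsum_shifted_card : exists v : nat -> nat -> R,
  (forall j (d : 'I_N) D, {in D, forall y : 'I_N, (y < d)%N} -> ncsum_shifted x j d D = v j #|D|) /\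
  (forall j m, v j m = shifted_step v j m).
Proof.
suff [v hv] : exists v : nat -> nat -> R, forall j m, v j m = shifted_step v j m.
  exists v; split => // j d D; move: {2}#|D|.+1 (ltnSn #|D|) => b; elim: b j d D => // b ih j d D hb Dd.
  have hn D' : (#|D'| <= #|D|)%N -> {in D', forall y : 'I_N, (y < d)%N} ->
     ncsum x D' = if #|D'| is m.+1 then v 0%N m else 1.
    case: (set_0Vmem D') => [->|[e0 e0D]] hD' D'd; first by rewrite cards0 ncsum_set0.
    have [e eD emax] := arg_maxnP (fun i : 'I_N => i : nat) e0D.
    have {}eD : e \in D' := eD.
    rewrite -{1}(setD1K eD) ncsum_is_shifted0 (cardsD1 e D') eD add1n.
    rewrite ih //.
      move: hD'; rewrite (cardsD1 e D') eD add1n => h; exact: leq_trans h hb.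
    move=> y; rewrite in_setD1 => /andP[ne yD].
    by rewrite ltn_neqAle (emax y yD : (y <= e)%N) andbT (inj_eq (@ord_inj N)).
  rewrite ncsum_shifted_rec // hv /shifted_step hn //; congr (_ + _).
  rewrite -(big_rank D (fun i => match (#|D| - i.+1)%N with 0%N => 1 | i'.+1 => v 0%N i' end * v j.+1 i)).
  apply: eq_bigr => e eD; rewrite -card_below_above // hn.
  - congr (_ * _); rewrite ih // => [|y]; last by rewrite inE => /andP[].
    rewrite -ltnS (leq_trans _ hb) // ltnS; apply: proper_card; apply/properP; split.
      by apply/subsetP => y; rewrite inE => /andP[].
    by exists e; rewrite // inE ltnn andbF.
  - by apply: subset_leq_card; apply/subsetP => y; rewrite inE => /andP[].
  - by move=> y; rewrite inE => /andP[/Dd].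
(* The solution is built with fuel [f]; its values at sizes below [f] no longer depend on [f]. *)
pose vf := fix vf (f : nat) := if f is f'.+1 then shifted_step (vf f') else fun _ _ => 0.
have vfE f f' j m : (m < f)%N -> (m < f')%N -> vf f j m = vf f' j m.
  elim: f f' j m => // f ih [//|f'] j m h h' /=; apply: eq_shifted_step => i n hn.
  by apply: ih; apply: leq_trans hn _.
exists (fun j m => vf m.+1 j m) => j m /=; apply: eq_shifted_step => i n hn.
exact: (vfE m n.+1 i n hn (ltnSn n)).
Qed.

(** With [V_j = sum_i v j i t^i] and [W = 1 + G = 1 + t V_0], the recursion reads
    [V_j = x_(j+1) W + t W V_(j+1)]. Unrolling it from [V_0] gives [G = sum_i x_i (tW)^i]. *)
Lemma ncsum_gf : (0 < N)%N -> exists w : nat -> R,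
  (forall D, D != set0 -> ncsum x D = w #|D|) /\
  let G := \poly_(i < N.+1) (if i == 0%N then 0 else w i) in
  let A := \poly_(i < N.+1) (if i == 0%N then 0 else x i) in
  eqmodX N G (A \Po ('X * (1 + G))).
Proof.
move=> N0; have [v [hv vE]] := ncsum_shifted_card.
exists (fun i => v 0%N i.-1); split.
  move=> D /set0Pn[d0 d0D].
  have [d dD dmax] := arg_maxnP (fun i : 'I_N => i : nat) d0D.
  have {}dD : d \in D := dD.
  rewrite -{1}(setD1K dD) ncsum_is_shifted0 (cardsD1 d D) dD add1n hv //= => y.
  rewrite in_setD1 => /andP[ne yD].
  by rewrite ltn_neqAle (dmax y yD : (y <= d)%N) andbT (inj_eq (@ord_inj N)).
set G := \poly_(i < _) _; set A := \poly_(i < _) _.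
case: N N0 @G @A => // M _ G A.
set W := 1 + G.
pose V j := \poly_(i < M.+1) v j i.
have GE : G = 'X * V 0%N.
  apply/polyP => i; rewrite coefXM !coef_poly; case: i => [|i] //=.
have Wc i : (i <= M.+1)%N -> W`_i = if i is i'.+1 then v 0%N i' else 1.
  by move=> hi; rewrite coefD coef1 coef_poly ltnS hi; case: i hi => [|i] hi /=; rewrite ?addr0 ?add0r.
have VE j : eqmodX M (V j) ((x j.+1)%:P * W + 'X * W * V j.+1).
  move=> i hi; rewrite coef_poly ltnS hi vE /shifted_step coefD coefCM Wc ?(leqW hi) //; congr (_ + _).
  rewrite -mulrA coefXM; case: i hi => [|i] hi /=; first by rewrite big_ord0.
  rewrite coefMr; apply: eq_bigr => k _; rewrite subSS coef_poly.
  have hk : (k <= i)%N by rewrite -ltnS.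
  rewrite Wc ?(leq_trans (leq_subr _ _)) ?(leqW (ltnW hi)) //.
  by rewrite ltnS (leq_trans hk (ltnW hi)).
have VN n : eqmodX M (V 0%N) (\sum_(i < n) (x i.+1)%:P * ('X ^+ i * W ^+ i.+1) + 'X ^+ n * W ^+ n * V n).
  elim: n => [|n ih]; first by rewrite big_ord0 add0r !expr0 !mul1r.
  apply: eqmodX_trans ih _; rewrite big_ord_recr /= -addrA; apply: eqmodXD => //.
  apply: eqmodX_trans (eqmodXM (@eqmodX_refl _ _ _) (VE n)) _.
  by apply: eq_eqmodX; rewrite !exprS; ring.
have AE : A \Po ('X * W) = 'X * \sum_(i < M.+1) (x i.+1)%:P * ('X ^+ i * W ^+ i.+1).
  rewrite /A poly_def rmorph_sum /= big_ord_recl /= scale0r comp_poly0 add0r mulr_sumr.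
  apply: eq_bigr => i _; rewrite /bump leq0n add1n comp_polyZ comp_Xn_poly -mul_polyC exprMn !exprS; ring.
move=> /= [|i] hi.
  by rewrite -/W AE GE !coefXM.
(* After [M + 1] unrollings the remainder is divisible by [X^(M+1)] and does not affect degree
   [i <= M]. *)
rewrite -/W AE GE !coefXM /= (VN M.+1) // coefD -mulrA coefXnM.
by rewrite hi addr0.
Qed.

End Sizes.

(** * Weighted multichains *)

Definition ncpart N (P : {set {set 'I_N}}) : bool :=
  partition P [set: 'I_N] && noncrossing P.

(* The multichains counted end with the one-block partition, so for [pi_1] the list [ss] is
   [s_2, ..., s_(l+1)]; meaningful only if [P] has [1 + sumn ss] blocks. *)
Fixpoint chains_above N (ss : seq nat) (P : {set {set 'I_N}}) : nat :=
  if ss is s :: ss' then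
    (\sum_(Q : {set {set 'I_N}} | [&& ncpart Q, refines P Q & #|Q| == (sumn ss').+1])
       chains_above ss' Q)%N
  else 1%N.

(** The series [A] up to degree [N]; its constant term is cleared because blocks are nonempty. *)
Definition blockgf (R : comNzRingType) N (x : nat -> R) : {poly R} :=
  \poly_(i < N.+1) (if i == 0%N then 0 else x i).

Lemma blockgf_lift (R : comNzRingType) N (x : nat -> R) :
  blockgf N (fun i => 'X * (x i)%:P) = 'X%:P * (blockgf N x)^:P.
Proof.
apply/polyP => i; rewrite coefCM coef_map /= !coef_poly.
by case: ifP => _; [case: ifP => _|]; rewrite ?mulr0.
Qed.

Lemma weight_lift (R : comNzRingType) N (x : nat -> R) (P : {set {set 'I_N}}) :
  weight (fun i => 'X * (x i)%:P) P = 'X^#|P| * (weight x P)%:P.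
Proof.
by rewrite /weight big_split /= prodr_const rmorph_prod.
Qed.

Lemma card1_ncpart N (P : {set {set 'I_N}}) : (0 < N)%N ->
  ncpart P && (#|P| == 1%N) = (P == [set [set: 'I_N]]).
Proof.
move=> N0; apply/andP/eqP => [[/andP[pP _] /cards1P[B PB]]|->].
  by rewrite PB -(cover_partition pP) PB /cover big_set1.
rewrite cards1; split => //; apply/andP; split; last first.
  by apply/noncrossingP => ? ?; rewrite !inE => /eqP -> /eqP ->; rewrite eqxx.
apply/and3P; split; rewrite ?inE; first by rewrite /cover big_set1.
  by apply/trivIsetP => ? ?; rewrite !inE => /eqP -> /eqP ->; rewrite eqxx.
by apply/eqP => /setP/(_ (Ordinal N0)); rewrite !inE.
Qed.

(** The induction is over all rings and weights at once: summing over the bottom element replaces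
    [x] by the weights [w] of noncrossing partitions, which live in [{poly R}] with variable [y]
    marking blocks. *)
Lemma weighted_chains N (R : idomainType) (R0 : forall n, n.+1%:R != 0 :> R)
    (x : nat -> R) (ss : seq nat) : (0 < N)%N ->
  (sumn ss).+1%:R *
    (\sum_(P : {set {set 'I_N}} | ncpart P && (#|P| == (sumn ss).+1))
       weight x P * (chains_above ss P)%:R) =
  (\prod_(s <- ss) 'C(N, s))%:R * (blockgf N x ^+ (sumn ss).+1)`_N.
Proof.
move=> N0; elim: ss R R0 x => [|s ss ih] R R0 x.
  rewrite big_nil !mul1r expr1 coef_poly ltnSn (negPf (lt0n_neq0 N0)).
  rewrite (big_pred1 [set [set: 'I_N]]) => [|P]; last by rewrite card1_ncpart.
  by rewrite mulr1 /weight big_set1 cardsT card_ord.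
have R0' n : n.+1%:R != 0 :> {poly R} by rewrite -polyC_natr polyC_eq0.
have [w [wE /=]] := ncsum_gf (fun i => 'X * (x i)%:P) N0.
rewrite -/(blockgf N w) -/(blockgf N _) blockgf_lift => GE.
have := ih _ R0' w.
(* This power of [y] selects the bottom partitions [P] with the prescribed number of blocks. *)
move/(congr1 (fun p : {poly R} => p`_((sumn ss).+1 + s))).
rewrite !mulr_natl !coefMn -!(mulr_natl _`_ _) coef_sum.
have step (Q : {set {set 'I_N}}) : ncpart Q ->
    (weight w Q * (chains_above ss Q)%:R)`_((sumn ss).+1 + s) =
    \sum_(P : {set {set 'I_N}} | [&& ncpart P, #|P| == (s + sumn ss).+1 & refines P Q])
      weight x P * (chains_above ss Q)%:R.
  move=> /andP[pQ nQ]; rewrite mulr_natr coefMn.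
  have -> : weight w Q = ncsum_refining (fun i => 'X * (x i)%:P) Q [set: 'I_N].
    have [_ tQ Q0] := and3P pQ.
    rewrite -(cover_partition pQ) ncsum_refining_prod //; apply: eq_bigr => C CQ.
    by rewrite wE // (partition_neq0 pQ CQ).
  rewrite /ncsum_refining coef_sum -mulr_suml mulr_natr; congr (_ *+ _).
  rewrite [LHS](bigID (fun P : {set {set 'I_N}} => #|P| == (s + sumn ss).+1)) /= [X in _ + X]big1.
    rewrite addr0; apply: eq_big => [P|P /andP[_ /eqP hP]].
      by rewrite -!andbA [_ && (#|P| == _)]andbC.
    by rewrite weight_lift coefMC coefXn hP addSn addnC eqxx mul1r.
  move=> P /andP[_ hP].
  by rewrite weight_lift coefMC coefXn addSn addnC eq_sym (negPf hP) mul0r.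
rewrite (eq_bigr _ (fun Q hQ => step Q (andP hQ).1)).
have := lagrange_forest R0 (sumn ss) s N0 GE.
set b2 := (sumn ss).+1; have -> : (sumn (s :: ss)).+1 = (b2 + s)%N by rewrite addSn /= addnC.
(* Both the induction hypothesis and the inversion formula carry the factor [b2], the number of
   blocks of [Q]; it is multiplied in and cancelled at the end. *)
move=> lag IH; apply: (mulfI (R0 (sumn ss))); rewrite -/b2.
rewrite big_cons natrM.
transitivity ((b2 + s)%:R * ((\prod_(s <- ss) 'C(N, s))%:R * (blockgf N w ^+ b2)`_N`_(b2 + s))).
  rewrite -IH [RHS]mulrCA -[in LHS](mulr_natl _ (b2 + s)); congr (_ * (_ * _)).
  under eq_bigr do rewrite /= natr_sum mulr_sumr.
  rewrite (exchange_big_dep (fun Q : {set {set 'I_N}} => ncpart Q && (#|Q| == b2))) /=.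
    apply: eq_bigr => Q /andP[nQ hQ]; apply: eq_bigl => P.
    by rewrite nQ hQ /= andbT -andbA addnC.
  by move=> P Q _ /and3P[-> _ ->].
by rewrite mulrCA lag; ring.
Qed.

(** * Extracting the block sizes *)

Lemma mcoeffMX_eq0 (n : nat) (R : nzRingType) (p : {mpoly R[n]}) (i : 'I_n) (m : 'X_{1..n}) :
  m i = 0%N -> (p * 'X_i)@_m = 0.
Proof.
move=> mi; apply/eqP; rewrite mcoeff_eq0 (perm_mem (msuppMX _ _)).
by apply/mapP => -[m' _ e]; move: mi; rewrite e mnmDE mnm1E eqxx.
Qed.

Lemma mcoeffMX_sub (n : nat) (R : nzRingType) (p : {mpoly R[n]}) (i : 'I_n) (m : 'X_{1..n}) :
  m i != 0%N -> (p * 'X_i)@_m = p@_(m - U_(i)).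
Proof. by move=> mi; rewrite -{1}(@submK _ U_(i)%MM m) ?lep1mP // addmC mcoeffMX. Qed.

(** The multinomial theorem without division; the degree in [t] is the one forced by [m]. Taking
    [X_j] from the first factor leaves [m - U_(j)], and the contributions [m_j b!] add up to
    [(b+1)!]. *)
Lemma multinomial_coeff (n : nat) (p : pred 'I_n) (f : 'I_n -> nat) (m : 'X_{1..n}) (b : nat) :
  (forall j, ~~ p j -> m j = 0%N) -> mdeg m = b ->
  let S : {poly {mpoly int[n]}} := \sum_(j | p j) 'X_j *: 'X^(f j) in
  ((S ^+ b)`_(\sum_j f j * m j)%N)@_m * (\prod_j (m j)`!)%:Z = (b`!)%:Z.
Proof.
move=> hp hm S; elim: b m hp hm => [|b ih] m hp hm.
  move/eqP: hm; rewrite mdeg_eq0 => /eqP ->.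
  rewrite !big1 /= => [|j _|j _]; rewrite ?mnm0E ?muln0 //.
  by rewrite expr0 coef1 eqxx mcoeff1 eqxx.
rewrite exprS mulr_suml coef_sum raddf_sum /= mulr_suml.
transitivity (\sum_(j | p j) ((m j) * b`!)%:Z); last first.
  rewrite -(big_morph _ PoszD (erefl 0%:Z)) /= -big_distrl /= factS -hm mdegE.
  congr (Posz (_ * _)); rewrite big_mkcond; apply: eq_bigr => j _.
  by case: (boolP (p j)) => // /hp.
apply: eq_bigr => j _; rewrite -scalerAl coefZ coefXnM [X in X@_m]mulrC.
case: (posnP (m j)) => [mj|mj].
  by rewrite mcoeffMX_eq0 // mul0r mj.
have le : (U_(j) <= m)%MM by rewrite lep1mP -lt0n.
set m' := (m - U_(j))%MM.
have mE : m = (m' + U_(j))%MM by rewrite submK.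
have hS : (\sum_i f i * m i)%N = (f j + \sum_i f i * m' i)%N.
  rewrite mE [LHS](eq_bigr (fun i => f i * m' i + f i * (j == i))%N) => [|i _]; last first.
    by rewrite mnmDE mnm1E mulnDr.
  rewrite big_split /= addnC; congr (_ + _)%N.
  by rewrite (bigD1 j) //= eqxx muln1 big1 ?addn0 // => i /negPf; rewrite eq_sym => ->; rewrite muln0.
rewrite hS ltnNge leq_addr /= addKn mcoeffMX_sub -?lt0n // -/m'.
have hP : (\prod_i (m i)`!)%N = (m j * \prod_i (m' i)`!)%N.
  rewrite (bigD1 j) //= [in RHS](bigD1 j) //= mulnA; congr (_ * _)%N.
    by rewrite mE mnmDE mnm1E eqxx addn1 factS.
  by apply: eq_bigr => i /negPf ij; rewrite mE mnmDE mnm1E eq_sym ij addn0.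
rewrite hP !PoszM mulrCA ih //.
  by move=> i /hp; rewrite mE mnmDE => /eqP; rewrite addn_eq0 => /andP[/eqP].
by move: hm; rewrite mE mdegD mdeg1 addn1 => -[].
Qed.

(** The exponent vector for which the weight of [P] is a single monomial. *)
Definition content N (P : {set {set 'I_N}}) : 'X_{1..N.+1} :=
  [multinom #|[set B in P | #|B| == i]| | i < N.+1].

Definition size_var N (i : nat) : {mpoly int[N.+1]} := 'X_(inord i).

Lemma weight_size_var N (P : {set {set 'I_N}}) : weight (size_var N) P = 'X_[content P].
Proof.
rewrite /weight -(big_morph _ (@mpolyXD _ _) (@mpolyX0 _ _)); congr 'X_[_]; apply/mnmP => i.
rewrite mnm_sumE mnmE -sum1dep_card [RHS]big_mkcond [LHS]big_mkcond /=.
apply: eq_bigr => B _; rewrite mnm1E; case: (B \in P) => //=.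
have hB : (#|B| < N.+1)%N by rewrite ltnS -[X in (_ <= X)%N](card_ord N) max_card.
by rewrite -(inj_eq (@ord_inj _)) inordK //; case: eqP.
Qed.

Lemma mdeg_content N (P : {set {set 'I_N}}) : mdeg (content P) = #|P|.
Proof.
rewrite mdegE -sum1_card (partition_big (fun B : {set 'I_N} => inord #|B| : 'I_N.+1) xpredT) //=.
apply: eq_bigr => i _; rewrite mnmE -sum1dep_card; apply: eq_bigl => B.
have hB : (#|B| < N.+1)%N by rewrite ltnS -[X in (_ <= X)%N](card_ord N) max_card.
by rewrite -[in RHS](inj_eq (@ord_inj _)) inordK.
Qed.

(* Taking the coefficient of the monomial [m] in [weighted_chains]. *)
Lemma chains_of_content N (ss : seq nat) (m : 'X_{1..N.+1}) : (0 < N)%N ->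
  m ord0 = 0%N -> (\sum_(i < N.+1) i * m i)%N = N -> mdeg m = (sumn ss).+1 ->
  ((\sum_(P : {set {set 'I_N}} | ncpart P && (content P == m)) chains_above ss P)
     * \prod_(i < N.+1) (m i)`! = (sumn ss)`! * \prod_(s <- ss) 'C(N, s))%N.
Proof.
move=> N0 m0 mN mdegm.
have R0 b : b.+1%:R != 0 :> {mpoly int[N.+1]}.
  apply/eqP => /(congr1 (fun p : {mpoly int[N.+1]} => p@_0%MM)).
  by rewrite -mpolyC_nat mcoeffC eqxx mulr1 mcoeff0 => /eqP; rewrite pnatr_eq0.
have := weighted_chains R0 (size_var N) ss N0.
move/(congr1 (fun p : {mpoly int[N.+1]} => p@_m)).
rewrite -!mpolyC_nat !mcoeffCM raddf_sum /=.
have -> : \sum_(P : {set {set 'I_N}} | ncpart P && (#|P| == (sumn ss).+1))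
    (weight (size_var N) P * (chains_above ss P)%:R)@_m =
  (\sum_(P : {set {set 'I_N}} | ncpart P && (content P == m)) chains_above ss P)%:R.
  rewrite natr_sum [LHS]big_mkcond [RHS]big_mkcond; apply: eq_bigr => P _.
  rewrite weight_size_var -mpolyC_nat mulrC mcoeffCM mcoeffX.
  case: (ncpart P) => //=; case: (eqVneq (content P) m) => [e|ne]; last by rewrite mulr0 if_same.
  by rewrite -(mdeg_content P) e mdegm eqxx mulr1.
set c := (\sum_(P | _) _)%N => h.
have hA : blockgf N (size_var N) =
    \sum_(j < N.+1 | j != ord0) ('X_j : {mpoly int[N.+1]}) *: 'X^j.
  rewrite /blockgf poly_def [RHS]big_mkcond; apply: eq_bigr => i _ /=.
  by rewrite -(inj_eq (@ord_inj _)) /=; case: eqP => /= _; rewrite ?scale0r // /size_var inord_val.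
(* The missing constant term of [A] matches the hypothesis [m ord0 = 0]. *)
have supp j : ~~ (j != ord0 :> 'I_N.+1) -> m j = 0%N by rewrite negbK => /eqP ->.
have := multinomial_coeff (fun i : 'I_N.+1 => i : nat) supp mdegm.
rewrite /= mN -hA => hB.
have : (sumn ss).+1%:R * (c%:R * (\prod_j (m j)`!)%:Z) =
   (\prod_(s <- ss) 'C(N, s))%:R * ((sumn ss).+1)`!%:Z :> int.
  by rewrite mulrA h -mulrA hB.
(* The factor [sumn ss + 1] of the weighted count cancels against the leading factor of the
   factorial. *)
rewrite -!natz -!natrM factS => /eqP; rewrite eqr_nat => /eqP.
by rewrite [RHS]mulnCA => /eqP; rewrite eqn_pmul2l // => /eqP ->; rewrite mulnC.
Qed.

Local Close Scope ring_scope.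
Local Open Scope nat_scope.

(** * Multichains in [NC^(k)(n;r)] *)

(** As [r < k], the positive multiples of [k] up to [kn + r] are [k, 2k, ..., nk]. *)
Lemma big_multiples (T : Type) (idx : T) (op : Monoid.com_law idx) (k n r : nat) (F : nat -> T) :
  r < k ->
  \big[op/idx]_(i < (k * n + r).+1 | (0 < i) && (k %| i)) F i =
  \big[op/idx]_(1 <= j < n.+1) F (k * j).
Proof.
move=> rk; rewrite -(big_mkord (fun i => (0 < i) && (k %| i))) -big_filter.
rewrite -(big_map (muln k) xpredT); apply: perm_big; apply: uniq_perm.
- by rewrite filter_uniq ?iota_uniq.
- by rewrite map_inj_uniq ?iota_uniq // => a b; nia.
move=> i; rewrite mem_filter mem_index_iota; apply/idP/mapP => [|[j]].
  case/andP => /andP[i0 /dvdnP[j e]] hi; exists j; last by rewrite mulnC.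
  by rewrite mem_index_iota; nia.
by rewrite mem_index_iota => hj ->; rewrite dvdn_mulr //; nia.
Qed.

Section Content.
Variables (N : nat).
Implicit Types P Q : {set {set 'I_N}}.

Lemma card_ord_set (B : {set 'I_N}) : #|B| < N.+1.
Proof. by rewrite ltnS -[X in _ <= X](card_ord N) max_card. Qed.

Lemma sum_by_size P (p : pred nat) (g : nat -> nat) :
  \sum_(B in P | p #|B|) g #|B| = \sum_(i < N.+1 | p i) g i * #|[set B in P | #|B| == i]|.
Proof.
rewrite (partition_big (fun B : {set 'I_N} => inord #|B| : 'I_N.+1) (fun i => p i)) /=; last first.
  by move=> B /andP[_]; rewrite inordK ?card_ord_set.
apply: eq_bigr => i pi; rewrite mulnC -sum_nat_const; apply: eq_big => [B|B].
  rewrite inE -(inj_eq (@ord_inj _)) inordK ?card_ord_set //.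
  by case: eqP => [->|]; rewrite ?andbF // pi !andbT.
by case/andP => _ /eqP <-; rewrite inordK ?card_ord_set.
Qed.

Lemma partition_size0 P : partition P [set: 'I_N] -> #|[set B in P | #|B| == 0]| = 0.
Proof.
move=> pP; apply/eqP; rewrite cards_eq0; apply/eqP/setP => B; rewrite !inE cards_eq0.
by case: eqP => [->|]; rewrite ?andbF // andbT; case/and3P: pP => _ _ /negPf.
Qed.

End Content.

Lemma card_inNCk k n r (P : {set {set 'I_(k * n + r)}}) : inNCk P -> #|P| = (bkp k P).+1.
Proof.
case/and3P => _ _ /eqP h; rewrite -(cardsID [set B : {set 'I_(k * n + r)} | k %| #|B|] P) -addn1 -h /bkp.
congr (_ + _); apply: eq_card => B; rewrite !inE //.
by rewrite andbC.
Qed.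

Lemma sum_multiples k n r (P : {set {set 'I_(k * n + r)}}) (g : nat -> nat) :
  r < k -> partition P [set: 'I_(k * n + r)] ->
  \sum_(B in P | k %| #|B|) g #|B| = \sum_(1 <= j < n.+1) g (k * j) * typeb k P j.
Proof.
move=> rk pP; rewrite sum_by_size.
rewrite -(@big_multiples _ _ _ _ _ r (fun i => g i * #|[set B in P | #|B| == i]|)) //.
rewrite [LHS](bigD1 ord0) ?dvdn0 //= partition_size0 // muln0 add0n.
by apply: eq_bigl => i; rewrite andbC lt0n -(inj_eq (@ord_inj _)).
Qed.

(** * The content determined by a type *)

Section Target.
Variables (k n r b : nat) (bs : nat -> nat).
Hypotheses (r0 : 0 < r) (rk : r < k).
Hypothesis hb : \sum_(1 <= i < n.+1) bs i = b.
Hypothesis hn : \sum_(1 <= i < n.+1) i * bs i <= n.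
Local Notation N := (k * n + r).

(* The size of the only block not divisible by [k]. *)
Definition special_size : nat := k * (n - \sum_(1 <= i < n.+1) i * bs i) + r.
Local Notation z := special_size.

(** The content that the type forces on [pi_1]. The cases do not collide, since [z] is not divisible
    by [k]. *)
Definition target : 'X_{1..N.+1} :=
  [multinom (if i == z :> nat then 1 else if (0 < i) && (k %| i) then bs (i %/ k) else 0)
     | i < N.+1].

Lemma special_size_bound : z < N.+1.
Proof. by rewrite /z ltnS leq_add2r leq_mul2l leq_subr orbT. Qed.

Lemma special_size_ndvd : ~~ (k %| z).
Proof. by rewrite /z dvdn_addr ?dvdn_mulr // gtnNdvd. Qed.

(** One tool for degree, total size and product of factorials: exponents vanish away from [z] and
    the multiples of [k], and there [F] is neutral. *)
Lemma big_target (T : Type) (idx : T) (op : Monoid.com_law idx) (F : nat -> nat -> T) :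
  (forall i, F i 0 = idx) ->
  \big[op/idx]_(i < N.+1) F i (target i) =
  op (F z 1) (\big[op/idx]_(1 <= j < n.+1) F (k * j) (bs j)).
Proof.
move=> F0; rewrite (bigD1 (Ordinal special_size_bound)) //= mnmE /= eqxx; congr (op _ _).
transitivity (\big[op/idx]_(1 <= j < n.+1) F (k * j) (bs (k * j %/ k))); last first.
  by apply: eq_bigr => j _; rewrite mulKn //; clear hb hn; lia.
rewrite -(@big_multiples _ _ _ _ _ r (fun i => F i (bs (i %/ k)))) //.
rewrite [LHS]big_mkcond [RHS]big_mkcond; apply: eq_bigr => i _ /=.
rewrite mnmE -(inj_eq (@ord_inj _)) /=; case: eqP => [->|_] /=.
  by rewrite (negPf special_size_ndvd) andbF.
by case: ifP => //; rewrite F0.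
Qed.

Lemma target0 : target ord0 = 0.
Proof.
rewrite mnmE ltnn andFb; case: eqP => // e.
by move: special_size_ndvd; rewrite -e dvdn0.
Qed.

Lemma mdeg_target : mdeg target = b.+1.
Proof. by rewrite mdegE (big_target addn (F := fun _ m => m)) //= hb. Qed.

Lemma size_target : \sum_(i < N.+1) i * target i = N.
Proof.
rewrite (big_target addn (F := fun i m => i * m)) => [|i]; last by rewrite muln0.
rewrite /=; under eq_bigr do rewrite -mulnA.
rewrite -big_distrr /= /z; clear hb; nia.
Qed.

Lemma fact_target : \prod_(i < N.+1) (target i)`! = \prod_(1 <= j < n.+1) (bs j)`!.
Proof. by rewrite (big_target muln (F := fun _ m => m`!)) //= mul1n. Qed.

Lemma target_multiple j : 1 <= j <= n -> forall i : 'I_N.+1, i = k * j :> nat -> target i = bs j.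
Proof.
move=> hj i e; rewrite mnmE e mulKn; last by clear hb hn; lia.
rewrite dvdn_mulr // andbT; case: eqP => [e'|_].
  by move: special_size_ndvd; rewrite -e' dvdn_mulr.
by case: ifP => //; clear hb hn; nia.
Qed.

(** The type does not mention the exceptional block, but the blocks partition [kn + r] elements, so
    its size is what the others leave over, namely [z]. *)
Lemma content_target (P : {set {set 'I_N}}) : ncpart P ->
  (content P == target) = inNCk P && has_type P b bs.
Proof.
move=> /andP[pP nP].
have typeE (i : 'I_N.+1) j : i = k * j :> nat -> content P i = typeb k P j.
  by move=> e; rewrite mnmE e.
apply/eqP/andP => [h|[/and3P[_ _ /cards1P[B0 hB0]] /andP[hs /forallP ht]]].
  have tb j : 1 <= j <= n -> typeb k P j = bs j.
    move=> hj; have hi : k * j < N.+1 by nia.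
    by rewrite -(typeE (Ordinal hi)) // h (target_multiple hj).
  split; last first.
    apply/andP; split; last by apply/forallP => i; rewrite tb //=.
    by rewrite -hb; apply/eqP; apply: eq_big_nat => j hj; rewrite tb.
  apply/and3P; split => //.
  rewrite -sum1dep_card (sum_by_size P (fun i => ~~ (k %| i)) (fun=> 1)).
  rewrite (bigD1 (Ordinal special_size_bound)) ?special_size_ndvd //=.
  have cE (i : 'I_N.+1) : #|[set B in P | #|B| == i]| = target i by rewrite -h mnmE.
  rewrite (cE (Ordinal special_size_bound)) [target _]mnmE /= eqxx big1 // => i /andP[hi hz].
  rewrite cE [target _]mnmE (negPf hi) andbF -(inj_eq (@ord_inj _)) /= in hz *.
  by rewrite (negPf hz).
have tb j : 1 <= j <= n -> typeb k P j = bs j.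
  case: j => // j hj; exact/eqP/(ht (Ordinal hj)).
have BP : B0 \in P by have := set11 B0; rewrite -hB0 inE => /andP[].
have B0d : ~~ (k %| #|B0|) by have := set11 B0; rewrite -hB0 inE => /andP[].
have B0z : #|B0| = z.
  have := card_partition pP; rewrite cardsT card_ord.
  rewrite (bigID (fun B : {set 'I_N} => k %| #|B|)) /= (sum_multiples id rk pP).
  rewrite (_ : \sum_(B in P | _) _ = #|B0|); last first.
    rewrite -[RHS](big_set1 addn B0 (fun B : {set 'I_N} => #|B|)) -hB0.
    by apply: eq_bigl => B; rewrite inE.
  rewrite (_ : \sum_(1 <= j < n.+1) _ = k * \sum_(1 <= j < n.+1) j * bs j).
    rewrite /z mulnBr => e; have := leq_mul (leqnn k) hn.
    have aux (S K c : nat) : K + r = S + c -> S <= K -> c = K - S + r by lia.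
    exact: aux.
  by rewrite big_distrr /=; apply: eq_big_nat => j hj; rewrite tb // mulnA.
apply/mnmP => i; rewrite [RHS]mnmE.
have [kd|knd] := boolP (k %| i); last first.
  rewrite andbF mnmE -B0z.
  rewrite (_ : [set B in P | #|B| == i] = if i == #|B0| :> nat then [set B0] else set0).
    by case: eqP => _; rewrite ?cards1 ?cards0.
  have eB0 B : B \in P -> ~~ (k %| #|B|) -> B = B0.
    by move=> BP' Bd; apply/set1P; rewrite -hB0 inE BP'.
  apply/setP => B; rewrite inE; case: (eqVneq (i : nat) #|B0|) => e; rewrite inE.
    apply/andP/eqP => [[BP' /eqP Bi]|-> //]; last by rewrite e.
    by apply: eB0; rewrite // Bi.
  apply/negP => /andP[BP' /eqP Bi]; move: e; rewrite -Bi (eB0 B) ?eqxx // Bi //.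
rewrite ifN; last by apply: contraTneq kd => ->; apply: special_size_ndvd.
case: posnP => [i0|i0]; first by rewrite mnmE i0 partition_size0.
case/dvdnP: kd => j e; rewrite (typeE i j) ?e ?mulnK; [|lia|lia].
by apply: tb; have := ltn_ord i; nia.
Qed.

End Target.

(** * Multichains with prescribed numbers of blocks *)

Section Chains.
Variable N : nat.
Implicit Types (P Q : {set {set 'I_N}}).

(** Ranks are expressed by numbers of blocks: above the member of index [i] the jumps [drop i ss]
    are still to come, each losing that many blocks, until one block is left. *)
Definition chain_of_ranks l (ss : seq nat) (c : {ffun 'I_l -> {set {set 'I_N}}}) : bool :=
  [forall i : 'I_l, ncpart (c i) && (#|c i| == (sumn (drop i ss)).+1)] &&
  [forall i : 'I_l, forall j : 'I_l, (j == i.+1 :> nat) ==> refines (c i) (c j)].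

Lemma chain_of_ranksP l ss (c : {ffun 'I_l -> {set {set 'I_N}}}) :
  reflect [/\ forall i : 'I_l, ncpart (c i),
              forall i : 'I_l, #|c i| = (sumn (drop i ss)).+1 &
              forall i j : 'I_l, j = i.+1 :> nat -> refines (c i) (c j)]
          (chain_of_ranks ss c).
Proof.
apply: (iffP andP) => [[/forallP h1 /forallP h2]|[h1 h2 h3]].
  split=> [i|i|i j e]; [by case/andP: (h1 i) | by case/andP: (h1 i) => _ /eqP |].
  by move: (h2 i) => /forallP/(_ j)/implyP; apply; rewrite e.
split; apply/forallP => i; first by rewrite h1 h2 eqxx.
by apply/forallP => j; apply/implyP => /eqP; apply: h3.
Qed.

Definition ffun_cons (T : Type) l (x : T) (c : {ffun 'I_l -> T}) : {ffun 'I_l.+1 -> T} :=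
  [ffun i => if unlift ord0 i is Some j then c j else x].

Lemma ffun_cons0 (T : Type) l (x : T) (c : {ffun 'I_l -> T}) : ffun_cons x c ord0 = x.
Proof. by rewrite ffunE unlift_none. Qed.

Lemma ffun_consS (T : Type) l (x : T) (c : {ffun 'I_l -> T}) i :
  ffun_cons x c (lift ord0 i) = c i.
Proof. by rewrite ffunE liftK. Qed.

Lemma chain_of_ranks_cons l s ss P (c : {ffun 'I_l.+1 -> {set {set 'I_N}}}) :
  chain_of_ranks (s :: ss) (ffun_cons P c) =
  [&& ncpart P, #|P| == (sumn (s :: ss)).+1, refines P (c ord0) & chain_of_ranks ss c].
Proof.
apply/chain_of_ranksP/and4P => [[h1 h2 h3]|[nP /eqP cP rP /chain_of_ranksP[h1 h2 h3]]].
  split.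
  - by have := h1 ord0; rewrite ffun_cons0.
  - by have := h2 ord0; rewrite ffun_cons0 => ->.
  - by have := h3 ord0 (lift ord0 ord0) erefl; rewrite ffun_cons0 ffun_consS.
  - apply/chain_of_ranksP; split=> [i|i|i j e].
    + by have := h1 (lift ord0 i); rewrite ffun_consS.
    + by have := h2 (lift ord0 i); rewrite ffun_consS.
    + have := h3 (lift ord0 i) (lift ord0 j); rewrite !ffun_consS; apply.
      by rewrite !lift0 e.
split=> [i|i|i j].
- by case: (unliftP ord0 i) => [i'|] ->; rewrite ?ffun_consS ?ffun_cons0.
- by case: (unliftP ord0 i) => [i'|] ->; rewrite ?ffun_consS ?ffun_cons0.
- case: (unliftP ord0 i) => [i'|] ->; case: (unliftP ord0 j) => [j'|] -> //;
    rewrite ?lift0 ?ffun_consS ?ffun_cons0 // => -[] e; first exact: h3.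
  by rewrite (_ : j' = ord0) //; apply: ord_inj.
Qed.

(** The first member is split off and the remaining chains are sorted by their own first member,
    which matches the recursion of [chains_above]. *)
Lemma card_chains_from (N0 : 0 < N) l ss P : size ss = l.+1 ->
    ncpart P -> #|P| = (sumn ss).+1 ->
  #|[set c : {ffun 'I_l.+1 -> {set {set 'I_N}}} | chain_of_ranks ss c & c ord0 == P]|
  = chains_above ss P.
Proof.
elim: l ss P => [|l ih] [//|s ss] P [hs] nP cP.
  case: ss hs cP => // _ cP.
  (* The last jump leads to the one-block partition, which is not a member of the chain and can be
     chosen in one way. *)
  rewrite (_ : chains_above _ _ = 1); last first.
    rewrite /= (big_pred1 [set [set: 'I_N]]) // => Q; rewrite andbCA card1_ncpart // andbC.
    apply: andb_idr => /eqP ->; apply/forallP => B; apply/implyP => _.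
    by apply/existsP; exists setT; rewrite set11 subsetT.
  apply/eqP/cards1P; exists [ffun=> P]; apply/setP => c; rewrite !inE.
  apply/andP/eqP => [[_ /eqP c0]|->].
    by apply/ffunP => i; rewrite ffunE -c0 (ord1 i).
  rewrite ffunE eqxx; split => //; apply/chain_of_ranksP; split=> [i|i|i j].
  - by rewrite ffunE.
  - by rewrite ffunE (ord1 i).
  - by rewrite (ord1 i) (ord1 j).
rewrite -sum1dep_card /=.
rewrite (reindex_onto (ffun_cons P) (fun c => [ffun i => c (lift ord0 i)])) /=; last first.
  move=> c /andP[_ /eqP c0]; apply/ffunP => i; rewrite ffunE.
  by case: (unliftP ord0 i) => [j|] ->; rewrite ?ffunE.
transitivity (\sum_(c : {ffun 'I_l.+1 -> {set {set 'I_N}}} |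
    refines P (c ord0) && chain_of_ranks ss c) 1).
  apply: eq_bigl => c; rewrite ffun_cons0 eqxx chain_of_ranks_cons nP cP eqxx /= andbT.
  rewrite [X in _ && X](_ : _ = true) ?andbT //; apply/eqP/ffunP => i.
  by rewrite ffunE ffun_consS.
rewrite (partition_big (fun c : {ffun 'I_l.+1 -> {set {set 'I_N}}} => c ord0)
  (fun Q => [&& ncpart Q, refines P Q & #|Q| == (sumn ss).+1])) /=; last first.
  by move=> c /andP[-> /chain_of_ranksP[-> /(_ ord0) -> _]]; rewrite drop0 /=.
apply: eq_bigr => Q /and3P[nQ rQ /eqP cQ]; rewrite -ih // -sum1dep_card.
by apply: eq_bigl => c; case: eqP => [->|]; rewrite ?andbF // rQ.
Qed.

End Chains.

(** Each counted block has at least [k] elements and [kn + r < k(n+1)]. This makes the truncated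
    subtraction in [rankNC] exact. *)
Lemma bkp_le k n r (P : {set {set 'I_(k * n + r)}}) : r < k -> inNCk P -> bkp k P <= n.
Proof.
move=> rk /and3P[pP _ _].
have : k * bkp k P <= k * n + r.
  have e := card_partition pP; rewrite cardsT card_ord in e; rewrite [X in _ <= X]e.
  rewrite (bigID (fun B : {set 'I_(k * n + r)} => k %| #|B|)) /=.
  apply: leq_trans (leq_addr _ _).
  rewrite /bkp -sum1dep_card big_distrr /=; apply: leq_sum => B /andP[BP Bk].
  rewrite muln1 dvdn_leq // lt0n cards_eq0; exact: partition_neq0 pP BP.
nia.
Qed.

(** A block of [Q] is a union of blocks of [P], so its size is divisible by [k] unless it contains
    the exceptional block [B0]. *)
Lemma inNCk_coarser k n r (P Q : {set {set 'I_(k * n + r)}}) :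
  r < k -> 0 < r -> inNCk P -> ncpart Q -> refines P Q -> inNCk Q.
Proof.
move=> rk r0 /and3P[pP _ /cards1P[B0 hB0]] /andP[pQ nQ] /refinesP rPQ.
apply/and3P; split => //.
have sizeE C : C \in Q -> #|C| = \sum_(B in P | B \subset C) #|B|.
  move=> CQ; have pC : partition [set B in P | B \subset C] C.
    apply: (@partition_restrict _ _ _ (~: C)).
    - by rewrite -setI_eq0 setICr.
    - by rewrite setUCr.
    - move=> B BP; have [E EQ BE] := rPQ B BP; case: (eqVneq E C) => [<-|ne]; first by rewrite BE.
      apply/orP; right; apply: subset_trans BE _; rewrite -disjoints_subset.
      by have [_ /trivIsetP t _] := and3P pQ; apply: t.
  by rewrite (card_partition pC); apply: eq_bigl => B; rewrite inE.
have B0P : B0 \in P by have := set11 B0; rewrite -hB0 inE => /andP[].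
have B0d : ~~ (k %| #|B0|) by have := set11 B0; rewrite -hB0 inE => /andP[].
have Pd B : B \in P -> B != B0 -> k %| #|B|.
  by move=> BP; apply: contraNT => Bd; rewrite -in_set1 -hB0 inE BP.
have [C0 C0Q BC0] := rPQ B0 B0P.
apply/cards1P; exists C0; apply/setP => C; rewrite !inE; apply/andP/eqP => [[CQ]|->].
  apply: contraNeq => ne; rewrite sizeE //; apply: dvdn_sum => B /andP[BP BC].
  apply: Pd => //; apply: contra_neq ne => e; subst B.
  have [b bB] := set0Pn _ (partition_neq0 pP B0P).
  have [_ t _] := and3P pQ.
  by rewrite -(def_pblock t CQ (subsetP BC b bB)) (def_pblock t C0Q (subsetP BC0 b bB)).
split=> //; rewrite sizeE // (bigD1 B0) ?B0P //= dvdn_addl //.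
by apply: dvdn_sum => B /andP[/andP[BP _]]; apply: Pd.
Qed.

(** * From rank jumps to numbers of blocks *)

Section Good.
Variables (n k r l b : nat) (bs s : nat -> nat).
Hypotheses (r0 : 0 < r) (rk : r < k).
Hypothesis hb : \sum_(1 <= i < n.+1) bs i = b.
Hypothesis hn : \sum_(1 <= i < n.+1) i * bs i <= n.
Hypothesis hs : \sum_(1 <= i < l.+3) s i = n.
Hypothesis hs1 : s 1 = n - b.

(** The chain has [l + 1] members here, so these are the jumps after the first one. *)
Let ss := [seq s i | i <- iota 2 l.+1].

Lemma blocks_le : b <= n.
Proof.
clear -hb hn; apply: leq_trans hn; rewrite -hb; rewrite [X in X <= _]big_nat_cond [X in _ <= X]big_nat_cond.
by apply: leq_sum => i; rewrite andbT => hi; nia.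
Qed.

Lemma sumn_jumps : sumn ss = b.
Proof.
rewrite sumnE big_map; have := hs; rewrite big_ltn // hs1 /index_iota subSS subSS subn0.
have := blocks_le; clear -hs1; lia.
Qed.

Lemma drop_jumps i : i <= l -> drop i ss = s i.+2 :: drop i.+1 ss.
Proof.
move=> hi; rewrite (drop_nth 0) ?size_map ?size_iota ?ltnS //.
by rewrite (nth_map 0) ?size_iota ?ltnS // nth_iota ?ltnS // addnC addn2.
Qed.

(** An element of the poset has one block more than [bkp] counts, so the rank conditions say
    [bkp k (c i) = sumn (drop i ss)]. *)
Lemma good_multichainE (c : {ffun 'I_l.+1 -> {set {set 'I_(k * n + r)}}}) :
  good_multichain b bs s c = chain_of_ranks ss c && (content (c ord0) == target k n r bs).
Proof.
apply/idP/andP.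
  case/and5P => /forallP hin /forallP href /forallP hr0 /forallP hrk /andP[_ /forallP ht].
  have nc i : ncpart (c i) by case/and3P: (hin i) => p1 p2 _; apply/andP.
  split; last first.
    rewrite (content_target r0 rk hb hn) // hin.
    by move: (ht ord0) => /implyP; apply.
  apply/chain_of_ranksP; split=> // [i|i j e]; last first.
    by move: (href i) => /forallP/(_ j)/implyP; apply; rewrite e.
  rewrite (card_inNCk (hin i)); congr _.+1.
  case: i => i hi /=; elim: i hi => [|i ih] hi.
    rewrite drop0 sumn_jumps.
    have := hr0 (Ordinal hi); rewrite /= => /eqP; rewrite /rankNC hs1.
    have := bkp_le rk (hin (Ordinal hi)); have := blocks_le; lia.
  have hi' : i < l.+1 by apply: ltnW.
  have := hrk (Ordinal hi') => /forallP/(_ (Ordinal hi)) /=; rewrite eqxx /= => /eqP.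
  have := ih hi'; rewrite drop_jumps -1?ltnS // [sumn (_ :: _)]/= /rankNC.
  have := bkp_le rk (hin (Ordinal hi)); have := bkp_le rk (hin (Ordinal hi')); lia.
case=> /chain_of_ranksP[nc hc href] /eqP hct.
have hc0 : inNCk (c ord0) && has_type (c ord0) b bs.
  by rewrite -(content_target r0 rk hb hn) // hct.
(* Membership is known for the first member from its content and passes upwards to coarser
   partitions. *)
have hin i : inNCk (c i).
  case: i => i hi; elim: i hi => [|i ih] hi.
    by case/andP: hc0 => + _; congr (inNCk (c _)); apply: ord_inj.
  have hi' : i < l.+1 by apply: ltnW.
  exact: inNCk_coarser rk r0 (ih hi') (nc _) (href (Ordinal hi') (Ordinal hi) erefl).
have hbk i : bkp k (c i) = sumn (drop i ss).
  by have := hc i; rewrite (card_inNCk (hin i)) => -[].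
have hle i := bkp_le rk (hin i).
apply/and5P; split; try apply/forallP => i.
- exact: hin.
- by apply/forallP => j; apply/implyP => /eqP; apply: href.
- apply/implyP => /eqP i0; rewrite /rankNC hbk i0 drop0 sumn_jumps hs1 //.
- apply/forallP => j; apply/implyP => /eqP e; apply/eqP.
  have := hle i; have := hle j; rewrite /rankNC !hbk e (@drop_jumps i) -1?ltnS //=; lia.
apply/andP; split; apply/forallP => i; apply/implyP => /eqP e.
  apply/eqP; have := hle i; rewrite /rankNC hbk e /= drop_jumps // drop_oversize //=.
    by lia.
  by rewrite size_map size_iota.
case/andP: hc0 => _; congr (has_type (c _) b bs); exact: ord_inj.
Qed.

Lemma card_good_multichain :
  #|[set c : {ffun 'I_l.+1 -> {set {set 'I_(k * n + r)}}} | good_multichain b bs s c]| =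
  \sum_(P : {set {set 'I_(k * n + r)}} | ncpart P && (content P == target k n r bs))
     chains_above ss P.
Proof.
rewrite -sum1dep_card.
rewrite (partition_big (fun c : {ffun 'I_l.+1 -> {set {set 'I_(k * n + r)}}} => c ord0)
  (fun P => ncpart P && (content P == target k n r bs))); last first.
  by move=> c; rewrite good_multichainE => /andP[/chain_of_ranksP[-> _ _] ->].
apply: eq_bigr => P /andP[nP cP]; rewrite -(@card_chains_from _ _ l) //.
- rewrite -sum1dep_card; apply: eq_bigl => c /=; rewrite good_multichainE.
  by case: (c ord0 =P P) => [->|_]; rewrite ?andbF // cP !andbT.
- by rewrite addn_gt0 r0 orbT.
- by rewrite size_map size_iota.
- by rewrite -mdeg_content (eqP cP) (mdeg_target r0 rk hb) // sumn_jumps.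
Qed.

End Good.

(** Splitting off one entry leaves a binomial coefficient as cofactor. The quotient defining
    [multinomial] is therefore exact. *)
Lemma prod_fact_dvd (ms : seq nat) : \prod_(m <- ms) m`! %| (sumn ms)`!.
Proof.
elim: ms => [|m ms ih]; first by rewrite big_nil.
rewrite big_cons /= -(bin_fact (leq_addr (sumn ms) m)) addKn dvdn_mull // dvdn_pmul2l ?fact_gt0 //.
Qed.

Theorem theorem4p5 (n k r l b : nat) (bs s : nat -> nat) :
  (0 < n)%N -> (0 < k)%N -> (0 < r)%N -> (0 < l)%N -> (r < k)%N ->
  \sum_(1 <= i < n.+1) bs i = b ->
  (\sum_(1 <= i < n.+1) i * bs i <= n)%N ->
  \sum_(1 <= i < l.+2) s i = n ->
  s 1 = n - b ->
  #|[set c : {ffun 'I_l -> {set {set 'I_(k * n + r)}}} |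
       good_multichain b bs s c]|
  = multinomial b [seq bs i | i <- iota 1 n] *
    \prod_(2 <= i < l.+2) 'C(k * n + r, s i).
Proof.
move=> n0 k0 r0; case: l => // l _ rk hb hn hs hs1.
rewrite (card_good_multichain r0 rk hb hn hs hs1).
set ss := [seq s i | i <- iota 2 l.+1]; set c := \sum_(P | _) _.
have N0 : 0 < k * n + r by rewrite addn_gt0 r0 orbT.
have sb := sumn_jumps hb hn hs hs1.
have mdegt : mdeg (target k n r bs) = (sumn ss).+1 by rewrite (mdeg_target r0 rk hb) // sb.
have := chains_of_content N0 (target0 n bs r0 rk) (size_target r0 rk hn) mdegt.
rewrite -/c (fact_target n bs r0 rk) sb => hc.
have bsE : \prod_(m <- [seq bs i | i <- iota 1 n]) m`! = \prod_(1 <= j < n.+1) (bs j)`!.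
  by rewrite big_map /index_iota subn1.
have ssE : \prod_(x <- ss) 'C(k * n + r, x) = \prod_(2 <= i < l.+3) 'C(k * n + r, s i).
  by rewrite big_map /index_iota !subSS subn0.
have dv : \prod_(1 <= j < n.+1) (bs j)`! %| b`!.
  have <- : sumn [seq bs i | i <- iota 1 n] = b by rewrite sumnE big_map -hb /index_iota subn1.
  by rewrite -bsE prod_fact_dvd.
(* The identity is compared after multiplication by the positive product of factorials. *)
rewrite /multinomial bsE -ssE; apply/eqP.
have P0 : 0 < \prod_(1 <= j < n.+1) (bs j)`! by apply: prodn_gt0 => j; apply: fact_gt0.
by rewrite -(eqn_pmul2r P0) hc mulnAC divnK.
Qed.
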